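(* Let $A \subset \mathbb{C}$ be any countable set, let $K \subset \mathbb{C}$ be a compact set with connected complement $\mathbb{C}\setminus K$ and without interior points, and let $f: K \to \mathbb{C}$ be a continuous function. Then given any $\varepsilon > 0$ there exists a polynomial $p$ (with complex coefficients) such that $p(z) \notin A$ for all $z \in K$ and such that $$\max_{z \in K} |f(z)-p(z)| < \varepsilon.$$ *)

(* Defs.v *)
From HB Require Import structures.
From mathcomp Require Import all_boot all_order all_algebra.
From mathcomp Require Import complex.
From mathcomp Require Import all_classical all_reals all_analysis.

Set Implicit Arguments.
Unset Strict Implicit.
Unset Printing Implicit Defensive.

Import Order.TTheory GRing.Theory Num.Theory.
Import numFieldNormedType.Exports.

Local Open Scope classical_set_scope.
Local Open Scope ring_scope.

(* [R[i]] itself carries no topology in the library; its regular-algebra alias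
   [R[i]^o] carries the topology of the modulus, i.e. the usual topology of the
   complex plane, and the points are those of [R[i]]. *)
Notation Cplane R := (R[i]^o) (only parsing).

(* An empty set has no maximum. *)
Definition is_maximum (d : Order.disp_t) (T : porderType d)
  (S : set T) (m : T) : Prop := S m /\ ubound S m.

(* Main.v *)
Require Import Defs.
From HB Require Import structures.
From mathcomp Require Import all_boot all_order all_algebra.
From mathcomp Require Import complex.
From mathcomp Require Import all_classical all_reals all_analysis.
From mathcomp Require Import ring lra.

Set Implicit Arguments.
Unset Strict Implicit.
Unset Printing Implicit Defensive.

Import Order.TTheory GRing.Theory Num.Theory.
Import numFieldNormedType.Exports.
Import ComplexField.Normc.

Local Open Scope classical_set_scope.
Local Open Scope ring_scope.

(* By Stone-Weierstrass it suffices to approximate [conjc] uniformly on [K] by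
   polynomials.  The sum of [d ^+ 2 / (z - c)] over the points [c] of a lattice of
   mesh [d] in a large square is nearly a constant multiple of [conjc z], because a
   translation of [z] by a lattice step only changes terms along two sides of the
   square.  As [K] has no interior and its complement is connected, near each [c]
   there is an arc off [K], of diameter comparable to [d], with end points [a] and
   [b]; a branch of the square root of [(z - a) * (z - b)] off that arc is a uniform
   limit of polynomials on [K], and a multiple of [z - (a + b) / 2] minus this root
   replaces [1 / (z - c)], with an error of order [d / (d ^+ 2 + |z - c| ^+ 2)].
   These errors add up to a quantity that tends to [0] with [d].

   If [p] is a non constant polynomial close to [f], then so is [p (z + t)] for small
   [t], and it takes a value in [A] on [K] only if [t] is in [p^-1(A) - K], a countable
   union of closed sets with empty interior; Baire's theorem gives a good [t]. *)

Local Notation Re := complex.Re.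
Local Notation Im := complex.Im.

(** * The real-valued modulus of complex numbers *)

Section Modulus.
Variable R : realType.
Implicit Types (x y z w : R[i]) (a b : R).

Lemma normc_norm z : (normc z)%:C%C = `|z|.
Proof. by []. Qed.

Lemma normc_ge0 z : 0 <= normc z.
Proof. by rewrite -lecR normc_norm normr_ge0. Qed.

Lemma normc_triangle x y : normc (x + y) <= normc x + normc y.
Proof. exact: le_normcD. Qed.

Lemma normc_opp x : normc (- x) = normc x.
Proof. exact: normcN. Qed.

Lemma normc_sub x y : normc (x - y) = normc (y - x).
Proof. by rewrite -normc_opp opprB. Qed.

Lemma normc_triangleB x y : normc (x - y) <= normc x + normc y.
Proof. by rewrite -(normc_opp y); exact: normc_triangle. Qed.

Lemma normc_subr_ge x y : normc x - normc y <= normc (x - y).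
Proof. by have := normc_triangle (x - y) y; rewrite subrK; lra. Qed.

Lemma normc_triangle3 y x z : normc (x - z) <= normc (x - y) + normc (y - z).
Proof. by have := normc_triangle (x - y) (y - z); rewrite addrA subrK. Qed.

Lemma normc_sqr z : normc z ^+ 2 = Re z ^+ 2 + Im z ^+ 2.
Proof. by case: z => a b /=; rewrite sqr_sqrtr // addr_ge0 ?sqr_ge0. Qed.

Lemma normc_real a : normc a%:C%C = `|a|.
Proof. by rewrite /= expr0n addr0 sqrtr_sqr. Qed.

Lemma normc_conj z : normc (conjc z) = normc z.
Proof. by case: z => a b /=; rewrite sqrrN. Qed.

Lemma normc_nat n : normc (n%:R : R[i]) = n%:R.
Proof. by rewrite -(rmorph_nat (real_complex R)) normc_real ger0_norm. Qed.

Lemma normcX z n : normc (z ^+ n) = normc z ^+ n.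
Proof. by elim: n => [|n IH]; rewrite ?normc1 // !exprS normcM IH. Qed.

Lemma normc_div x y : normc (x / y) = normc x / normc y.
Proof. by rewrite normcM normcV. Qed.

Lemma normc_gt0 z : (0 < normc z) = (z != 0).
Proof.
rewrite lt_neqAle normc_ge0 andbT eq_sym; congr (~~ _).
by apply/eqP/eqP => [/eq0_normc//|->]; rewrite normc0.
Qed.

Lemma normc_i : normc ('i%C : R[i]) = 1.
Proof. by rewrite /= expr0n /= expr1n add0r sqrtr1. Qed.

Lemma mul_conjc z : z * conjc z = (normc z ^+ 2)%:C%C.
Proof. by rewrite -sqr_normc -normc_norm rmorphXn. Qed.

Lemma Re_le_normc z : `|Re z| <= normc z.
Proof. by rewrite -lecR; exact: normc_ge_Re. Qed.

Lemma Im_le_normc z : `|Im z| <= normc z.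
Proof.
rewrite -(@ler_pXn2r _ 2) ?nnegrE ?normr_ge0 ?normc_ge0 //.
by rewrite normc_sqr real_normK ?num_real // lerDr sqr_ge0.
Qed.

Lemma normc_le_ReIm z : normc z <= `|Re z| + `|Im z|.
Proof.
rewrite -(@ler_pXn2r _ 2) ?nnegrE ?normc_ge0 ?addr_ge0 ?normr_ge0 //.
rewrite normc_sqr -[Re z ^+ 2]real_normK ?num_real // -[Im z ^+ 2]real_normK ?num_real //.
have := normr_ge0 (Re z); have := normr_ge0 (Im z); nra.
Qed.

Lemma normc_sum (I : Type) (r : seq I) (P : pred I) (F : I -> R[i]) :
  normc (\sum_(i <- r | P i) F i) <= \sum_(i <- r | P i) normc (F i).
Proof.
apply: (big_ind2 (fun x a => normc x <= a)) => //.
  by rewrite normc0.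
by move=> x a y b xa yb; apply: le_trans (normc_triangle _ _) _; exact: lerD.
Qed.

End Modulus.

(** * Uniform limits of polynomials *)

Section UniformClosure.
Variable R : realType.
Variable K : set R[i].
Implicit Types (f g u v : R[i] -> R[i]) (p q : {poly R[i]}).

(* The uniform algebra usually written P(K). *)
Definition uniform_limit_of_polys f := forall eps : R, 0 < eps ->
  exists p, forall z, K z -> normc (f z - p.[z]) < eps.
Local Notation PK := uniform_limit_of_polys.

Lemma exprV2_lt (eps : R) : 0 < eps -> exists n, (2^-1) ^+ n < eps.
Proof.
move=> e0; exists (Num.bound eps^-1); rewrite exprVn.
rewrite invf_plt ?posrE ?exprn_gt0 //.
exact: upper_nthrootP.
Qed.

Lemma PK_ext f g : (forall z, K z -> f z = g z) -> PK f -> PK g.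
Proof.
move=> fg Pf e e0; have [p Hp] := Pf e e0.
by exists p => z Kz; rewrite -fg // Hp.
Qed.

Lemma PK_poly p : PK (fun z => p.[z]).
Proof. by move=> e e0; exists p => z _; rewrite subrr normc0. Qed.

Lemma PK_cst c : PK (fun=> c).
Proof. by apply: PK_ext (PK_poly c%:P) => z _; rewrite hornerC. Qed.

Lemma PK_id : PK id.
Proof. by apply: PK_ext (PK_poly 'X) => z _; rewrite hornerX. Qed.

Lemma PK_lim f : (forall eps : R, 0 < eps ->
  exists2 g, PK g & forall z, K z -> normc (f z - g z) < eps) -> PK f.
Proof.
move=> H e e0; have e20 : 0 < e / 2 by lra.
have [g Pg fg] := H _ e20; have [p gp] := Pg _ e20.
exists p => z Kz; have := normc_triangle3 (g z) (f z) p.[z].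
have := fg z Kz; have := gp z Kz; lra.
Qed.

Lemma PK_add f g : PK f -> PK g -> PK (fun z => f z + g z).
Proof.
move=> Pf Pg e e0; have e20 : 0 < e / 2 by lra.
have [p Hp] := Pf _ e20; have [q Hq] := Pg _ e20.
exists (p + q) => z Kz; rewrite hornerD.
have -> : f z + g z - (p.[z] + q.[z]) = (f z - p.[z]) + (g z - q.[z]) by ring.
have := normc_triangle (f z - p.[z]) (g z - q.[z]).
have := Hp z Kz; have := Hq z Kz; lra.
Qed.

Lemma PK_sum (I : Type) (r : seq I) (F : I -> R[i] -> R[i]) :
  (forall i, PK (F i)) -> PK (fun z => \sum_(i <- r) F i z).
Proof.
move=> PF; elim: r => [|i r IH].
  by apply: PK_ext (PK_cst 0) => z _; rewrite big_nil.
by apply: PK_ext (PK_add (PF i) IH) => z _; rewrite big_cons.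
Qed.

Hypothesis bndK : exists M : R, forall z, K z -> normc z <= M.

Lemma poly_bounded p : exists2 B : R, 0 < B & forall z, K z -> normc p.[z] <= B.
Proof.
have [M HM] := bndK.
elim/poly_ind: p => [|p c [B B0 HB]].
  by exists 1 => // z _; rewrite horner0 normc0.
exists (B * `|M| + normc c + 1).
  have := normc_ge0 c; have : 0 <= B * `|M| by rewrite mulr_ge0 // ltW.
  lra.
move=> z Kz; rewrite hornerMXaddC.
have := normc_triangle (p.[z] * z) c; rewrite normcM.
have : normc p.[z] * normc z <= B * `|M|.
  apply: ler_pM; rewrite ?normc_ge0 ?HB //.
  exact: le_trans (HM z Kz) (ler_norm _).
lra.
Qed.

Lemma PK_bounded f : PK f -> exists2 B : R, 0 < B & forall z, K z -> normc (f z) <= B.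
Proof.
move=> /(_ 1 ltr01)[p Hp]; have [B B0 HB] := poly_bounded p.
exists (B + 1); first lra.
move=> z Kz; have := normc_triangle (f z - p.[z]) p.[z]; rewrite subrK.
have := Hp z Kz; have := HB z Kz; lra.
Qed.

Lemma PK_mul f g : PK f -> PK g -> PK (fun z => f z * g z).
Proof.
move=> Pf Pg e e0.
have [B B0 HB] := PK_bounded Pf.
have [|q Hq] := Pg (e / 2 / B); first by rewrite !divr_gt0.
have [C C0 HC] := poly_bounded q.
have [|p Hp] := Pf (e / 2 / C); first by rewrite !divr_gt0.
exists (p * q) => z Kz; rewrite hornerM.
have -> : f z * g z - p.[z] * q.[z] = f z * (g z - q.[z]) + q.[z] * (f z - p.[z]) by ring.
apply: le_lt_trans (normc_triangle _ _) _; rewrite !normcM.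
have h1 : normc (f z) * normc (g z - q.[z]) <= B * normc (g z - q.[z]).
  by rewrite ler_wpM2r ?normc_ge0 ?HB.
have h2 : normc q.[z] * normc (f z - p.[z]) <= C * normc (f z - p.[z]).
  by rewrite ler_wpM2r ?normc_ge0 ?HC.
have := Hp z Kz; have := Hq z Kz; rewrite !ltr_pdivlMr // => h3 h4; nra.
Qed.

Lemma PK_scale c f : PK f -> PK (fun z => c * f z).
Proof. by move=> Pf; apply: PK_mul => //; exact: PK_cst. Qed.

Lemma PK_opp f : PK f -> PK (fun z => - f z).
Proof. by move=> Pf; apply: PK_ext (PK_scale (-1) Pf) => z _; rewrite mulN1r. Qed.

Lemma PK_sub f g : PK f -> PK g -> PK (fun z => f z - g z).
Proof. by move=> Pf Pg; apply: PK_add => //; exact: PK_opp. Qed.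

(* Picard iteration for [v = (u - v ^+ 2) / 2], where [1 + v] is the square root. *)
Lemma PK_sqrt u : PK u -> (forall z, K z -> normc (u z) <= 4^-1) ->
  exists2 s, PK s & forall z, K z -> s z ^+ 2 = 1 + u z /\ normc (s z - 1) <= normc (u z).
Proof.
move=> Pu u4.
pose v z := sqrtc (1 + u z) - 1.
have sE z : (1 + v z) ^+ 2 = 1 + u z by rewrite /v addrC subrK sqr_sqrtc.
(* The principal root has nonnegative real part, so [2 + v z] has modulus at least 1, while
   [v z * (2 + v z) = u z]. *)
have v_le z : normc (v z) <= normc (u z).
  have Re0 : 0 <= Re (sqrtc (1 + u z)).
    by rewrite /sqrtc; case: (1 + u z) => a b /=; exact: sqrtr_ge0.
  have h : 1 <= normc (2 + v z).
    apply: le_trans (Re_le_normc _); apply: le_trans (ler_norm _).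
    have -> : 2 + v z = 1 + sqrtc (1 + u z) by rewrite /v; ring.
    by move: Re0; case: (sqrtc _) => a b /=; lra.
  have : v z * (2 + v z) = u z.
    have e : u z = (1 + v z) ^+ 2 - 1 by rewrite sE; ring.
    by rewrite e; ring.
  move/(congr1 (@normc R)); rewrite normcM => <-.
  by rewrite ler_peMr ?normc_ge0.
have vfix z : v z = (u z - v z ^+ 2) / 2.
  have e : u z = (1 + v z) ^+ 2 - 1 by rewrite sE; ring.
  by rewrite e; field.
pose it n := iter n (fun w z => (u z - w z ^+ 2) / 2) (fun=> 0).
have Pit n : PK (it n).
  elim: n => [|n IH] /=; first exact: PK_cst.
  apply: PK_mul; last exact: PK_cst.
  by apply: PK_sub => //; apply: PK_ext (PK_mul IH IH) => z _; rewrite expr2.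
have err n z : K z -> normc (v z - it n z) <= (2^-1) ^+ n * 4^-1.
  move=> Kz; elim: n => [|n IH] /=.
    by rewrite subr0 expr0 mul1r; exact: le_trans (v_le z) (u4 z Kz).
  (* The second factor is [- (v z + it n z)], written through the previous error so that the
     induction hypothesis bounds it by 1/4 + 2/4. Each iteration thus contracts the error by 3/8,
     which is below 1/2. *)
  have -> : v z - (u z - it n z ^+ 2) / 2 = (v z - it n z) * ((v z - it n z) - 2 * v z) / 2.
    by rewrite {1}vfix; field.
  rewrite normc_div normcM normc_nat.
  have h1 : normc (v z - it n z - 2 * v z) <= 3 / 4.
    apply: le_trans (normc_triangleB _ _) _; rewrite normcM normc_nat.
    have : (2^-1) ^+ n <= 1 :> R by rewrite exprn_ile1 //; lra.
    have := v_le z; have := u4 z Kz; lra.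
  have h2 := normc_ge0 (v z - it n z).
  have h3 : 0 <= normc (v z - it n z - 2 * v z) := normc_ge0 _.
  rewrite exprS; nra.
exists (fun z => 1 + v z); last first.
  by move=> z Kz; split; [exact: sE | rewrite addrC addKr].
apply: PK_add; first exact: PK_cst.
apply: PK_lim => e e0; have [n Hn] := exprV2_lt e0.
exists (it n) => // z Kz; apply: le_lt_trans (err n z Kz) _.
have : 0 <= (2^-1) ^+ n :> R by rewrite exprn_ge0 //; lra.
lra.
Qed.

(** The iterates are the partial sums of the geometric series of [u], and each step multiplies the
    error by [u z]. *)
Lemma PK_geometric u : PK u -> (forall z, K z -> normc (u z) <= 2^-1) ->
  PK (fun z => (1 - u z)^-1).
Proof.
move=> Pu u2.
pose it n := iter n (fun w z => 1 + u z * w z) (fun=> 0).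
have Pit n : PK (it n).
  elim: n => [|n IH] /=; first exact: PK_cst.
  by apply: PK_add; [exact: PK_cst | exact: PK_mul].
have h1 z : K z -> 2^-1 <= normc (1 - u z).
  move=> Kz; have := normc_subr_ge 1 (u z); rewrite normc1.
  have := u2 z Kz; lra.
have err n z : K z -> normc ((1 - u z)^-1 - it n z) <= (2^-1) ^+ n * 2.
  move=> Kz; have h1z := h1 z Kz.
  have nz : 1 - u z != 0 by rewrite -normc_gt0; lra.
  elim: n => [|n IH] /=.
    rewrite subr0 expr0 mul1r normcV -[leRHS]invrK lef_pV2 ?posrE //; lra.
  have -> : (1 - u z)^-1 - (1 + u z * it n z) = u z * ((1 - u z)^-1 - it n z).
    by field.
  rewrite normcM exprS -mulrA ler_pM ?normc_ge0 //; exact: u2.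
apply: PK_lim => e e0; have [|n Hn] := @exprV2_lt (e / 2); first lra.
exists (it n) => // z Kz; apply: le_lt_trans (err n z Kz) _; lra.
Qed.

End UniformClosure.

(** * Square roots along arcs off K *)

Section Arc.
Variable R : realType.

(** The topological hypotheses on [K] in metric form, which is easy to rescale. Connectedness of the
    complement becomes an induction principle: what holds at one point off [K] and is locally
    constant there propagates to every point off [K]. *)
Record lavrentiev_set (K : set R[i]) : Prop := LavrentievSet {
  lav_bounded : exists M : R, forall z, K z -> normc z <= M;
  lav_closed : forall a, ~ K a ->
    exists2 r : R, 0 < r & forall z, K z -> r <= normc (z - a);
  lav_thin : forall c (r : R), 0 < r -> exists2 a, ~ K a & normc (a - c) < r;
  lav_connected : forall P : R[i] -> Prop,
    (exists2 b, ~ K b & P b) ->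
    (forall a, ~ K a -> exists2 r : R, 0 < r &
       forall b, ~ K b -> normc (b - a) < r -> P a <-> P b) ->
    forall b, ~ K b -> P b }.

Variable K : set R[i].
Hypothesis LK : lavrentiev_set K.
Local Notation PK := (uniform_limit_of_polys K).
Let bndK := lav_bounded LK.

Lemma lav_far (M : R) a : exists2 b, ~ K b & M < normc (b - a).
Proof.
have [N HN] := bndK.
pose x : R := `|N| + `|M| + normc a + 1.
have xE : normc (x%:C%C : R[i]) = x.
  rewrite normc_real ger0_norm //.
  by rewrite /x !addr_ge0 ?normr_ge0 ?normc_ge0.
exists x%:C%C => [Kx|].
  have := HN _ Kx; rewrite xE.
  have := ler_norm N; have := normr_ge0 M; have := normc_ge0 a; rewrite /x; lra.
have := normc_subr_ge x%:C%C a; rewrite xE.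
have := ler_norm M; have := normr_ge0 N; rewrite /x; lra.
Qed.

(** Pole pushing: [z - b = (z - a) * (1 - (b - a) / (z - a))], and the inverse of the last factor is
    a geometric series of ratio at most 1/2. *)
Lemma PK_inv_push a b : (forall z, K z -> z != a /\ 2 * normc (b - a) <= normc (z - a)) ->
  PK (fun z => (z - a)^-1) -> PK (fun z => (z - b)^-1).
Proof.
move=> ab Pa.
have Pu : PK (fun z => (b - a) * (z - a)^-1) by exact: PK_scale.
have u2 z : K z -> normc ((b - a) * (z - a)^-1) <= 2^-1.
  move=> Kz; have [za h] := ab z Kz.
  have : 0 < normc (z - a) by rewrite normc_gt0 subr_eq0.
  rewrite normc_div => h0; rewrite ler_pdivrMr //; lra.
apply: PK_ext (PK_mul bndK Pa (PK_geometric bndK Pu u2)) => z Kz.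
have [za h] := ab z Kz.
have za0 : 0 < normc (z - a) by rewrite normc_gt0 subr_eq0.
have zb : z - b != 0.
  rewrite -normc_gt0; have := normc_subr_ge (z - a) (b - a).
  have -> : z - a - (b - a) = z - b by ring.
  lra.
have e : 1 - (b - a) * (z - a)^-1 = (z - b) / (z - a).
  by field; rewrite subr_eq0.
by rewrite e; field; rewrite zb subr_eq0 za.
Qed.

(** As in Runge's theorem: for a pole far out the geometric series in [z / b] converges on [K], and
    short pushes in both directions make the property locally constant off [K]. *)
Lemma PK_inv b : ~ K b -> PK (fun z => (z - b)^-1).
Proof.
move: b; apply: (lav_connected LK).
  have [M HM] := bndK.
  have [b Kb bM] := lav_far (2 * `|M| + 1) 0; rewrite subr0 in bM.
  have b0 : b != 0 by rewrite -normc_gt0; have := normr_ge0 M; lra.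
  exists b => //.
  have Pu : PK (fun z => b^-1 * z) by apply: PK_scale => //; exact: PK_id.
  have u2 z : K z -> normc (b^-1 * z) <= 2^-1.
    move=> Kz; have bz : 0 < normc b by rewrite normc_gt0.
    rewrite mulrC normc_div ler_pdivrMr //.
    have := HM z Kz; have := ler_norm M; lra.
  apply: PK_ext (PK_scale bndK (- b^-1) (PK_geometric bndK Pu u2)) => z Kz.
  have bz : z - b != 0.
    rewrite -normc_gt0 normc_sub; have := normc_subr_ge b z.
    have := HM z Kz; have := ler_norm M; have := normr_ge0 M; lra.
  have e : 1 - b^-1 * z = - (z - b) / b by field.
  by rewrite e; field; rewrite b0 bz.
move=> a Ka; have [r r0 Hr] := lav_closed LK Ka.
exists (r / 4) => [|b Kb ab]; first lra.
split; apply: PK_inv_push => z Kz; have := Hr z Kz => h.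
  split; last lra.
  by rewrite -subr_eq0 -normc_gt0; lra.
have h' := normc_subr_ge (z - a) (b - a).
have e : z - a - (b - a) = z - b by ring.
rewrite {}e in h'; rewrite (normc_sub a).
split; last lra.
by rewrite -subr_eq0 -normc_gt0; lra.
Qed.

(** Here [(z - a) / (z - b) = 1 + (b - a) / (z - b)] is within 1/4 of 1, where [PK_sqrt] applies. *)
Lemma PK_sqrt_step a b : ~ K b ->
  (forall z, K z -> 4 * normc (b - a) <= normc (z - b)) ->
  exists2 s, PK s & forall z, K z -> s z ^+ 2 * (z - b) = z - a /\ normc (s z - 1) <= 4^-1.
Proof.
move=> Kb ab; have Pu := PK_scale bndK (b - a) (PK_inv Kb).
have zb z : K z -> z - b != 0.
  by move=> Kz; rewrite subr_eq0; apply/eqP => zb; rewrite zb in Kz.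
have u4 z : K z -> normc ((b - a) * (z - b)^-1) <= 4^-1.
  move=> Kz; have zb0 : 0 < normc (z - b) by rewrite normc_gt0 zb.
  rewrite normc_div ler_pdivrMr //; have := ab z Kz; lra.
have [s Ps Hs] := PK_sqrt bndK Pu u4.
exists s => // z Kz; have [-> h] := Hs z Kz; split.
  by field; exact: zb.
exact: le_trans h (u4 z Kz).
Qed.

(* [s] is the branch of the square root of [(z - a) / (z - b)] on the complement
   of an arc from [a] to [b] off [K]; away from the arc it is the principal one. *)
Definition sqrt_branch a b := exists2 s, PK s & forall z, K z ->
  s z ^+ 2 * (z - b) = z - a /\ (4 <= normc (z - a) -> normc (s z - 1) < 1).

(** The new branch is the product of the old one and a short step. The closeness to 1 survives
    because [(s z - 1) * (s z + 1) * (z - b) = b - a] first improves the bound 1 to 1/3 far from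
    [a]; the step adds at most 1/4, and 1/3 + 1/4 + 1/12 < 1. *)
Lemma sqrt_branch_step a b b' : normc (b - a) < 1 -> ~ K b' ->
  (forall z, K z -> 4 * normc (b' - b) <= normc (z - b')) ->
  sqrt_branch a b -> sqrt_branch a b'.
Proof.
move=> ba Kb' bb' [s Ps Hs]; have [t Pt Ht] := PK_sqrt_step Kb' bb'.
exists (fun z => s z * t z); first exact: PK_mul.
move=> z Kz; have [s2 s1] := Hs z Kz; have [t2 t1] := Ht z Kz; split.
  by rewrite exprMn -mulrA t2.
move=> za; have {}s1 := s1 za.
have zb : 3 <= normc (z - b).
  have := normc_subr_ge (z - a) (b - a).
  have -> : z - a - (b - a) = z - b by ring.
  lra.
have sp1 : 1 <= normc (s z + 1).
  have := normc_subr_ge 2 (1 - s z).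
  have -> : 2 - (1 - s z) = s z + 1 by ring.
  rewrite normc_nat normc_sub; lra.
have s3 : normc (s z - 1) <= 3^-1.
  have e : (s z - 1) * (s z + 1) * (z - b) = b - a.
    have -> : (s z - 1) * (s z + 1) * (z - b) = s z ^+ 2 * (z - b) - (z - b) by ring.
    by rewrite s2; ring.
  move/(congr1 (@normc R)): e; rewrite !normcM => e.
  have h0 := normc_ge0 (s z - 1).
  have : normc (s z - 1) * 1 * 3 <= normc (s z - 1) * normc (s z + 1) * normc (z - b).
    by rewrite ler_pM ?ler_pM ?mulr_ge0.
  lra.
have -> : s z * t z - 1 = (s z - 1) * (t z - 1) + ((s z - 1) + (t z - 1)) by ring.
have := normc_triangle (s z - 1) (t z - 1).
have := normc_triangle ((s z - 1) * (t z - 1)) ((s z - 1) + (t z - 1)).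
rewrite normcM; have := normc_ge0 (s z - 1); have := normc_ge0 (t z - 1); nra.
Qed.

Lemma sqrt_branch_refl a : sqrt_branch a a.
Proof.
exists (fun=> 1); first exact: PK_cst.
by move=> z _; rewrite expr1n mul1r subrr normc0.
Qed.

(** Otherwise no chain of short steps from [a] could cross the annulus between radii 1 and 2: being
    within 1 of [a] and reached by a branch would be locally constant off [K], hence true even of a
    point far away. *)
Lemma exists_sqrt_branch a : ~ K a ->
  exists b, [/\ 1 <= normc (b - a), normc (b - a) <= 2 & sqrt_branch a b].
Proof.
move=> Ka; apply: contrapT => /forallNP noB.
have [b Kb ab] := lav_far 1 a.
suff : forall b, ~ K b -> normc (b - a) < 1 /\ sqrt_branch a b.
  by move=> /(_ b Kb)[]; lra.
apply: (lav_connected LK).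
  exists a => //; rewrite subrr normc0; split; [lra|exact: sqrt_branch_refl].
have step c c' : ~ K c' -> normc (c' - c) <= 1 ->
    (forall z, K z -> 4 * normc (c' - c) <= normc (z - c')) ->
    normc (c - a) < 1 /\ sqrt_branch a c -> normc (c' - a) < 1 /\ sqrt_branch a c'.
  move=> Kc' cc' dc' [ca sc]; have sc' := sqrt_branch_step ca Kc' dc' sc.
  split=> //; rewrite ltNge; apply/negP => h; apply: (noB c'); split=> //.
  have := normc_triangle3 c c' a; lra.
move=> c Kc; have [r r0 Hr] := lav_closed LK Kc.
(* Within [r / 5] of [c] every point stays [4 * r / 5] away from [K], so the step is admissible both
   from [c] to [c'] and back. *)
exists (Num.min 1 (r / 5)) => [|c' Kc'].
  by rewrite lt_min ltr01; lra.
rewrite lt_min => /andP[h1 h2].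
have h3 z : K z -> 4 * normc (c' - c) <= normc (z - c').
  move=> Kz; have := normc_subr_ge (z - c) (c' - c).
  have -> : z - c - (c' - c) = z - c' by ring.
  have := Hr z Kz; lra.
split; apply: step => //; rewrite ?(normc_sub c); try lra.
by move=> z Kz; have := Hr z Kz; lra.
Qed.

End Arc.

(** * A bounded Cauchy kernel and its approximation by means of a square root *)

Section Kernel.
Variable R : realType.
Implicit Types (z w : R[i]).

(* A bounded substitute for [w^-1]. *)
Definition cauchy_kernel w : R[i] := conjc w / (1 + normc w ^+ 2)%:C%C.
Local Notation ker := cauchy_kernel.

Lemma ker_den_gt0 w : 0 < 1 + normc w ^+ 2.
Proof. by rewrite ltr_pwDl // sqr_ge0. Qed.

Lemma ker_den_neq0 w : (1 + normc w ^+ 2)%:C%C != 0 :> R[i].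
Proof.
rewrite -normc_gt0 normc_real normr_gt0; exact: lt0r_neq0 (ker_den_gt0 w).
Qed.

Lemma normc_ker w : normc (ker w) = normc w / (1 + normc w ^+ 2).
Proof. by rewrite normc_div normc_conj normc_real gtr0_norm ?ker_den_gt0. Qed.

Lemma normc_ker_le1 w : normc (ker w) <= 1.
Proof.
rewrite normc_ker ler_pdivrMr ?ker_den_gt0 // mul1r.
by have := normc_ge0 w; nra.
Qed.

Lemma inv_sub_ker w : w != 0 -> w^-1 - ker w = (w * (1 + normc w ^+ 2)%:C%C)^-1.
Proof.
move=> w0; have := ker_den_neq0 w; rewrite /ker => h.
have e : conjc w = (normc w ^+ 2)%:C%C / w by rewrite -mul_conjc mulrC mulKf.
rewrite e; move: h; rewrite rmorphD rmorph1 /=.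
by move: (real_complex _ _) => n h; field; rewrite h w0.
Qed.

(** Real arithmetic for the far case of [PK_approx_ker], with [H], [D], [X], [Y], [r] the moduli of
    [h z], [d], [z - a], [z - m], [z - c]. As [X] is comparable to [r], the left side is at most
    [5 / 2 * (H * X) ^+ 2], so at most [40 * D ^+ 2], and [Y] is at least 3. *)
Lemma far_bound (H D X Y r : R) : 0 <= H -> 0 <= D <= 1 -> 3 <= r -> 2 * r <= 3 * X ->
  3 <= Y -> H * X <= 4 * D ^+ 2 -> H ^+ 2 * (1 + r ^+ 2) <= 14 * (D ^+ 2 * Y).
Proof.
move=> H0 /andP[D0 D1] r3 rX Y3 HX.
have X0 : 0 <= X by lra.
have r2 : 1 + r ^+ 2 <= 5 / 2 * X ^+ 2.
  clear - r3 rX; have : 9 <= r ^+ 2 by nra.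
  have : (2 * r) ^+ 2 <= (3 * X) ^+ 2 by rewrite ler_pXn2r ?nnegrE //; lra.
  have -> : (2 * r) ^+ 2 = 4 * r ^+ 2 by ring.
  have -> : (3 * X) ^+ 2 = 9 * X ^+ 2 by ring.
  lra.
have D2 : (D ^+ 2) ^+ 2 <= D ^+ 2.
  by rewrite expr2 ler_piMl ?sqr_ge0 // exprn_ile1.
have HX2 : (H * X) ^+ 2 <= 16 * D ^+ 2.
  apply: (@le_trans _ _ ((4 * D ^+ 2) ^+ 2)).
    by rewrite ler_pXn2r ?nnegrE ?mulr_ge0 ?sqr_ge0.
  have -> : (4 * D ^+ 2) ^+ 2 = 16 * (D ^+ 2) ^+ 2 by ring.
  lra.
apply: (@le_trans _ _ (5 / 2 * (H * X) ^+ 2)).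
  have -> : 5 / 2 * (H * X) ^+ 2 = H ^+ 2 * (5 / 2 * X ^+ 2) by ring.
  by rewrite ler_wpM2l ?sqr_ge0.
have : D ^+ 2 * 3 <= D ^+ 2 * Y by rewrite ler_wpM2l ?sqr_ge0.
have := sqr_ge0 D; lra.
Qed.

Variable K : set R[i].
Hypothesis LK : lavrentiev_set K.
Local Notation PK := (uniform_limit_of_polys K).

(* With [q ^+ 2 = (z - a) * (z - b)] and [h = z - (a + b) / 2 - q], the function
   [h] is bounded near [a] and equivalent to [(b - a) ^+ 2 / (8 * z)] at infinity. *)
Lemma PK_approx_ker c : exists2 g, PK g & forall z, K z ->
  normc (g z - ker (z - c)) <= 3000 / (1 + normc (z - c) ^+ 2).
Proof.
have [a Ka ac] := lav_thin LK c (@ltr01 R).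
have [b [ab1 ab2 [s Ps Hs]]] := exists_sqrt_branch LK Ka.
have bndK := lav_bounded LK.
pose m := (a + b) / 2; pose d := (b - a) / 2.
have aE : a = m - d by rewrite /m /d; field.
have bE : b = m + d by rewrite /m /d; field.
have dE : 2 * normc d = normc (b - a) by rewrite /d normc_div normc_nat; field.
have d1 : 2^-1 <= normc d by lra.
have d2 : normc d <= 1 by lra.
have d0 : d != 0 by rewrite -normc_gt0; lra.
(* The product [(z - b) * s z] is the root [q], and [m] is the midpoint of [a] and [b]. *)
pose h z := (z - m) - (z - b) * s z.
have Ph : PK h.
  apply: PK_sub => //; first by apply: PK_sub => //; [exact: PK_id | exact: PK_cst].
  by apply: PK_mul => //; apply: PK_sub => //; [exact: PK_id | exact: PK_cst].
exists (fun z => 2 / d ^+ 2 * h z); first exact: PK_scale.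
move=> z Kz; have [s2 s1] := Hs z Kz.
set rho := normc (z - c); set X := normc (z - a) in s1.
have rho0 : 0 <= rho := normc_ge0 _.
have rX : `|rho - X| <= 1.
  rewrite ler_norml; have := normc_triangle3 a z c; have := normc_triangle3 c z a.
  rewrite (normc_sub c) -/rho -/X; lra.
have den0 := ker_den_gt0 (z - c); rewrite -/rho in den0.
have q2 : ((z - b) * s z) ^+ 2 = (z - m) ^+ 2 - d ^+ 2.
  have -> : ((z - b) * s z) ^+ 2 = (z - b) * (s z ^+ 2 * (z - b)) by ring.
  by rewrite s2 aE bE; ring.
have zm1 : normc (z - m) <= X + 1.
  have := normc_triangle3 a z m; rewrite -/X.
  have -> : a - m = - d by rewrite aE; ring.
  rewrite normc_opp; lra.
have zm2 : X - 1 <= normc (z - m).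
  have := normc_subr_ge (z - a) d; rewrite -/X.
  have -> : z - a - d = z - m by rewrite aE; ring.
  lra.
have hP : h z * ((z - m) + (z - b) * s z) = d ^+ 2.
  have -> : h z * ((z - m) + (z - b) * s z) = (z - m) ^+ 2 - ((z - b) * s z) ^+ 2.
    by rewrite /h; ring.
  by rewrite q2; ring.
(* Closeness of [s] to 1 is known from distance 4 on. Nearer to [a], crude bounds are enough: the
   two terms are at most 80 and 1, [1 + rho ^+ 2] is at most 26, and 81 * 26 < 3000. *)
have [X4|X4] := ltP X 4.
  have zb : normc (z - b) <= 6.
    by have := normc_triangle3 a z b; rewrite (normc_sub a) -/X; lra.
  have q5 : normc ((z - b) * s z) <= 5.
    have : normc ((z - b) * s z) ^+ 2 <= 24.
      rewrite -normcX.
      have -> : ((z - b) * s z) ^+ 2 = (z - b) * (s z ^+ 2 * (z - b)) by ring.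
      rewrite s2 normcM -/X.
      have -> : 24 = 6 * 4 :> R by ring.
      by rewrite ler_pM ?normc_ge0 // ltW.
    have := normc_ge0 ((z - b) * s z); nra.
  have h10 : normc (h z) <= 10.
    apply: le_trans (normc_triangleB _ _) _; lra.
  have g80 : normc (2 / d ^+ 2 * h z) <= 80.
    rewrite normcM normc_div normc_nat normcX.
    have : 2 / normc d ^+ 2 <= 8.
      by clear - d1; rewrite ler_pdivrMr; nra.
    have := normc_ge0 (h z); have : 0 <= 2 / normc d ^+ 2.
      by rewrite divr_ge0 ?sqr_ge0.
    nra.
  have := normc_triangleB (2 / d ^+ 2 * h z) (ker (z - c)).
  have := normc_ker_le1 (z - c).
  rewrite ler_pdivlMr //.
  move: rX; rewrite ler_norml => /andP[_ rX] k1 tr.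
  have r5 : rho <= 5 by lra.
  have := normc_ge0 (2 / d ^+ 2 * h z - ker (z - c)).
  move: (normc (_ - _)) tr => E tr E0; nra.
have rho3 : 3 <= rho by move: rX; rewrite ler_norml; lra.
have Xr : 2 * rho <= 3 * X by move: rX; rewrite ler_norml; lra.
have yr : rho <= 3 * normc (z - m) by move: rX; rewrite ler_norml; lra.
have y3 : 3 <= normc (z - m) by lra.
have y0 : z - m != 0 by rewrite -normc_gt0; lra.
have w0 : z - c != 0 by rewrite -normc_gt0 -/rho; lra.
(* With [s z] within 1 of 1 there is no cancellation: the modulus is at least [(X - 2) - 1], which
   is at least [X / 4] once [X] is at least 4. This makes [h z] small, by [hP]. *)
have P4 : X / 4 <= normc ((z - m) + (z - b) * s z).
  have -> : (z - m) + (z - b) * s z = (z - b) * (1 + s z) - (- d).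
    by rewrite bE; ring.
  apply: le_trans (normc_subr_ge _ _); rewrite normc_opp normcM.
  have : 1 <= normc (1 + s z).
    have := normc_subr_ge 2 (1 - s z).
    have -> : 2 - (1 - s z) = 1 + s z by ring.
    rewrite normc_nat normc_sub; have := s1 X4; lra.
  have : X - 2 <= normc (z - b).
    have := normc_subr_ge (z - a) (b - a); rewrite -/X.
    have -> : z - a - (b - a) = z - b by ring.
    lra.
  nra.
have hX : normc (h z) * X <= 4 * normc d ^+ 2.
  rewrite -normcX -hP normcM; have := normc_ge0 (h z); nra.
(* The comparison passes through [(z - m)^-1] and [(z - c)^-1], with total constant 14 + 7 + 1 = 22.
   The first error is exact: [2 * (z - m) * h z - d ^+ 2 = h z ^+ 2]. *)
have E1 : normc (2 / d ^+ 2 * h z - (z - m)^-1) <= 14 / (1 + rho ^+ 2).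
  have -> : 2 / d ^+ 2 * h z - (z - m)^-1 = h z ^+ 2 / (d ^+ 2 * (z - m)).
    have e : 2 * (z - m) * h z - d ^+ 2 = h z ^+ 2 by rewrite -hP /h; ring.
    by rewrite -e; field; rewrite y0 d0.
  rewrite normc_div (normcM (d ^+ 2)) !normcX ler_pdivrMr; last first.
    by rewrite mulr_gt0 ?exprn_gt0 //; lra.
  rewrite mulrAC ler_pdivlMr //.
  by apply: far_bound hX; rewrite ?normc_ge0.
have E2 : normc ((z - m)^-1 - (z - c)^-1) <= 7 / (1 + rho ^+ 2).
  have -> : (z - m)^-1 - (z - c)^-1 = (m - c) / ((z - m) * (z - c)).
    by field; rewrite y0 w0.
  rewrite normc_div normcM -/rho ler_pdivrMr; last by rewrite mulr_gt0; lra.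
  rewrite mulrAC ler_pdivlMr //.
  have mc : normc (m - c) <= 2.
    have := normc_triangle3 a m c.
    have -> : m - a = d by rewrite aE; ring.
    lra.
  have := normc_ge0 (m - c); nra.
have E3 : normc ((z - c)^-1 - ker (z - c)) <= 1 / (1 + rho ^+ 2).
  rewrite inv_sub_ker // normcV normcM -/rho normc_real gtr0_norm //.
  rewrite div1r lef_pV2 ?posrE ?mulr_gt0 //; last lra.
  by rewrite ler_peMl //; lra.
have := normc_triangle3 (z - m)^-1 (2 / d ^+ 2 * h z) (ker (z - c)).
have := normc_triangle3 (z - c)^-1 (z - m)^-1 (ker (z - c)).
have : 22 / (1 + rho ^+ 2) <= 3000 / (1 + rho ^+ 2).
  by rewrite ler_pM2r ?invr_gt0 //; lra.
lra.
Qed.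

End Kernel.

(** * Lattice sums *)

Section Lattice.
Variable R : realType.
Implicit Types (z w u v : R[i]) (N n a b : nat).
Local Notation ker := (@cauchy_kernel R).

Lemma ker_sub u v : normc (ker u - ker v) <=
  normc (u - v) * (1 + normc u * normc v) / ((1 + normc u ^+ 2) * (1 + normc v ^+ 2)).
Proof.
have hu := ker_den_neq0 u; have hv := ker_den_neq0 v.
have -> : ker u - ker v = (conjc (u - v) + conjc u * conjc v * (v - u)) /
    ((1 + normc u ^+ 2)%:C%C * (1 + normc v ^+ 2)%:C%C).
  have eu : (1 + normc u ^+ 2)%:C%C = 1 + u * conjc u :> R[i].
    by rewrite mul_conjc rmorphD rmorph1.
  have ev : (1 + normc v ^+ 2)%:C%C = 1 + v * conjc v :> R[i].
    by rewrite mul_conjc rmorphD rmorph1.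
  rewrite /ker rmorphB /=; move: hu hv; rewrite eu ev => hu hv.
  move: (conjc u) (conjc v) hu hv => cu cv hu hv.
  by field; rewrite hu hv.
rewrite normc_div normcM !normc_real !gtr0_norm ?ker_den_gt0 //.
apply: ler_wpM2r; first by rewrite invr_ge0 mulr_ge0 // ltW ?ker_den_gt0.
apply: le_trans (normc_triangle _ _) _.
by rewrite !normcM !normc_conj (normc_sub v); lra.
Qed.

Lemma ker_sub_far u v : 0 < normc u -> 0 < normc v ->
  normc (ker u - ker v) <= normc (u - v) / (normc u * normc v).
Proof.
move=> u0 v0; apply: le_trans (ker_sub _ _) _.
rewrite -mulrA ler_wpM2l ?normc_ge0 //.
have p0 : 0 < normc u * normc v by rewrite mulr_gt0.
rewrite ler_pdivrMr ?mulr_gt0 ?ker_den_gt0 // [leRHS]mulrC ler_pdivlMr //.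
by move: (normc u) (normc v) u0 v0 p0 => x y x0 y0 p0; have := sqr_ge0 (x - y); nra.
Qed.

Lemma ker_sub_near u v : normc (u - v) <= 2 ->
  normc (ker u - ker v) <= 4 / (1 + normc v ^+ 2).
Proof.
move=> uv; apply: le_trans (ker_sub _ _) _.
have hu := ker_den_gt0 u; have hv := ker_den_gt0 v.
rewrite ler_pdivrMr ?mulr_gt0 //.
have -> : 4 / (1 + normc v ^+ 2) * ((1 + normc u ^+ 2) * (1 + normc v ^+ 2)) =
    4 * (1 + normc u ^+ 2) by field; exact: lt0r_neq0.
have vu : normc v <= normc u + 2.
  by have := normc_subr_ge v u; rewrite normc_sub; lra.
have h : 1 + normc u * normc v <= 2 * (1 + normc u ^+ 2).
  by have := normc_ge0 u; have := sqr_ge0 (normc u - 1); nra.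
have : normc (u - v) * (1 + normc u * normc v) <= 2 * (2 * (1 + normc u ^+ 2)).
  by rewrite ler_pM ?normc_ge0 // addr_ge0 ?mulr_ge0 ?normc_ge0.
lra.
Qed.

(** The shift by [N] centres the square of lattice points at the origin, which makes it invariant
    under multiplication by ['i%C]. *)
Definition lattice_pt N a b : R[i] := ((a%:R - N%:R) +i* (b%:R - N%:R))%C.

Definition lattice_sum (f : R[i] -> R[i]) N w : R[i] :=
  \sum_(a < N.*2.+1) \sum_(b < N.*2.+1) f (w - lattice_pt N a b).

(** The kernel summed over the right side of the square minus its sum over the left side: the
    approximate increment of the lattice sum under a unit translation, hence the factor of
    [conjc w]. It tends to the number pi as [N] grows. *)
Definition lattice_const N : R :=
  \sum_(b < N.*2.+1) 2 * N%:R / (1 + N%:R ^+ 2 + (b%:R - N%:R) ^+ 2).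

Lemma natr_double1 N : N.*2.+1%:R = 2 * N%:R + 1 :> R.
Proof. by rewrite -addn1 natrD -mul2n natrM. Qed.

Lemma rev_ord_coord N (a : 'I_N.*2.+1) : (rev_ord a)%:R - N%:R = - (a%:R - N%:R) :> R.
Proof.
rewrite /= subSS natrB; last by rewrite -ltnS.
move: (a : nat) => k.
by rewrite -mul2n natrM; ring.
Qed.

Lemma ker_mul_i w : ker ('i%C * w) = - 'i%C * ker w.
Proof.
have e : conjc ('i%C * w) = - 'i%C * conjc w.
  by case: w => x y; apply/eqP; rewrite eq_complex /=; apply/andP; split; apply/eqP; ring.
by rewrite /ker e normcM normc_i mul1r mulrA.
Qed.

Lemma lattice_reindex_i (V : nmodType) (F : R[i] -> V) N :
  \sum_(a < N.*2.+1) \sum_(b < N.*2.+1) F (lattice_pt N a b) =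
  \sum_(a < N.*2.+1) \sum_(b < N.*2.+1) F ('i%C * lattice_pt N a b).
Proof.
rewrite exchange_big /=.
rewrite (eq_bigr (fun b : 'I__ => \sum_(a < N.*2.+1) F (lattice_pt N (rev_ord a) b))).
  apply: eq_bigr => a _; apply: eq_bigr => b _; congr F.
  rewrite /lattice_pt rev_ord_coord; apply/eqP.
  by rewrite eq_complex /=; apply/andP; split; apply/eqP; ring.
by move=> b _; rewrite (reindex_inj rev_ord_inj).
Qed.

(** The lattice sum turns in the same way as [conjc], so control along the real direction gives
    control along the imaginary one. *)
Lemma lattice_sum_mul_i N w : lattice_sum ker N ('i%C * w) = - 'i%C * lattice_sum ker N w.
Proof.
rewrite /lattice_sum (lattice_reindex_i (fun c => ker ('i%C * w - c))).
rewrite mulr_sumr; apply: eq_bigr => a _; rewrite mulr_sumr; apply: eq_bigr => b _.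
by rewrite -mulrBr ker_mul_i.
Qed.

(** The sum over columns telescopes: a unit translation brings in one column and drops another, both
    at distance about [N]. Replacing them by the columns of [lattice_const] costs
    [4 * (normc w + 1) / N%:R ^+ 2] per row, over [2 * N + 1 <= 3 * N] rows. *)
Lemma lattice_sum_step N w : (0 < N)%N -> 2 * (normc w + 1) <= N%:R ->
  normc (lattice_sum ker N (w + 1) - lattice_sum ker N w - (lattice_const N)%:C%C)
    <= 12 * (normc w + 1) / N%:R.
Proof.
move=> N0 wN; have w0 := normc_ge0 w.
have NR : 1 <= N%:R :> R by rewrite ler1n.
pose y b : R := b%:R - N%:R.
pose u b : R[i] := (N%:R +i* - y b)%C; pose v b : R[i] := (- N%:R +i* - y b)%C.
pose F a : R[i] := \sum_(b < N.*2.+1) ker (w + 1 - lattice_pt N a b).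
have -> : lattice_sum ker N (w + 1) - lattice_sum ker N w = F 0%N - F N.*2.+1.
  have -> : F 0%N - F N.*2.+1 = - (\sum_(0 <= a < N.*2.+1) (F a.+1 - F a)).
    by rewrite telescope_sumr // opprB.
  rewrite big_mkord /lattice_sum -sumrB -sumrN.
  apply: eq_bigr => a _; rewrite opprB; congr (_ - _); apply: eq_bigr => b _.
  congr ker; rewrite /lattice_pt; case: w {wN w0 F} => x x'; apply/eqP.
  by rewrite eq_complex /=; apply/andP; split; apply/eqP; ring.
have -> : F 0%N = \sum_(b < N.*2.+1) ker (w + 1 + u b).
  apply: eq_bigr => b _; congr (ker (_ + _)); rewrite /lattice_pt /u /y; apply/eqP.
  by rewrite eq_complex /=; apply/andP; split; apply/eqP; ring.
have -> : F N.*2.+1 = \sum_(b < N.*2.+1) ker (w + v b).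
  apply: eq_bigr => b _; congr ker; rewrite -addrA; congr (_ + _).
  rewrite /lattice_pt /v /y natr_double1; apply/eqP.
  by rewrite eq_complex /=; apply/andP; split; apply/eqP; ring.
have -> : (lattice_const N)%:C%C = \sum_(b < N.*2.+1) (ker (u b) - ker (v b)).
  rewrite /lattice_const rmorph_sum; apply: eq_bigr => b _.
  rewrite /ker !normc_sqr /= -/(y b) !sqrrN -mulrBl.
  rewrite rmorphM; congr (_ * _); last by rewrite -fmorphV addrA.
  by apply/eqP; rewrite eq_complex /=; apply/andP; split; apply/eqP; ring.
rewrite -!sumrB.
(* Since [normc c] is at most half of [N], the point [c + x] keeps modulus at least [N%:R / 2]. *)
have bd c x : normc x = N%:R \/ N%:R <= normc x -> normc c <= normc w + 1 ->
    normc (ker (c + x) - ker x) <= 2 * (normc w + 1) / N%:R ^+ 2.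
  move=> xN cw; have {}xN : N%:R <= normc x by case: xN => [->|].
  have h : N%:R / 2 <= normc (c + x).
    by have := normc_triangleB (c + x) c; rewrite addrC addKr; lra.
  apply: le_trans (ker_sub_far _ _) _; try lra.
  have -> : c + x - x = c by ring.
  rewrite ler_pdivrMr; last by rewrite mulr_gt0; lra.
  have N2 : 0 < N%:R ^+ 2 :> R by rewrite exprn_gt0; lra.
  rewrite mulrAC ler_pdivlMr //.
  have : N%:R / 2 * N%:R <= normc (c + x) * normc x by apply: ler_pM; lra.
  have := normc_ge0 c; move: (normc (c + x) * normc x) => p c0 hp.
  apply: (@le_trans _ _ ((normc w + 1) * N%:R ^+ 2)); first by rewrite ler_pM2r.
  rewrite -mulrA mulrCA; apply: ler_wpM2l; first lra.
  rewrite expr2; lra.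
have yN x b : normc (x +i* y b)%C >= `|x|.
  exact: (Re_le_normc (x +i* y b)%C).
apply: le_trans (normc_sum _ _ _) _.
apply: (@le_trans _ _ (\sum_(b < N.*2.+1) (4 * (normc w + 1) / N%:R ^+ 2))).
  apply: ler_sum => b _.
  have -> : ker (w + 1 + u b) - ker (w + v b) - (ker (u b) - ker (v b)) =
    (ker (w + 1 + u b) - ker (u b)) - (ker (w + v b) - ker (v b)) by ring.
  apply: le_trans (normc_triangleB _ _) _.
  have h1 : N%:R <= normc (u b).
    by have := Re_le_normc (u b); rewrite /= ger0_norm //.
  have h2 : N%:R <= normc (v b).
    by have := Re_le_normc (v b); rewrite /= normrN ger0_norm //.
  have w1 : normc (w + 1) <= normc w + 1.
    by have := normc_triangle w 1; rewrite normc1.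
  have := bd (w + 1) (u b) (or_intror h1) w1.
  have w2 : normc w <= normc w + 1 by lra.
  have := bd w (v b) (or_intror h2) w2.
  lra.
rewrite sumr_const card_ord -[_ *+ _]mulr_natr.
rewrite natr_double1.
have -> : 4 * (normc w + 1) / N%:R ^+ 2 * (2 * N%:R + 1) =
  4 * (2 + N%:R^-1) * ((normc w + 1) / N%:R).
  by field; lra.
have -> : 12 * (normc w + 1) / N%:R = 12 * ((normc w + 1) / N%:R) by rewrite mulrA.
rewrite ler_wpM2r ?divr_ge0 //; try lra.
have : N%:R^-1 <= 1 :> R by rewrite invf_le1; lra.
lra.
Qed.

Lemma lattice_const_ge1 N : (0 < N)%N -> 1 <= lattice_const N.
Proof.
move=> N0; have NR : 1 <= N%:R :> R by rewrite ler1n.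
have t (b : 'I_N.*2.+1) : 2 * N%:R / (1 + 2 * N%:R ^+ 2) <=
    2 * N%:R / (1 + N%:R ^+ 2 + (b%:R - N%:R) ^+ 2) :> R.
  rewrite ler_wpM2l ?mulr_ge0 //.
  have h : (b%:R - N%:R) ^+ 2 <= N%:R ^+ 2 :> R.
    rewrite -[leLHS]real_normK ?num_real // ler_pXn2r ?nnegrE ?normr_ge0 //.
    have : b%:R <= 2 * N%:R :> R.
      by rewrite -natrM ler_nat mul2n -ltnS.
    have : 0 <= b%:R :> R by [].
    by rewrite ler_norml; lra.
  have n2 := sqr_ge0 (N%:R : R); have b2 := sqr_ge0 (b%:R - N%:R : R).
  rewrite lef_pV2 ?posrE; lra.
apply: (@le_trans _ _ (\sum_(b < N.*2.+1) (2 * N%:R / (1 + 2 * N%:R ^+ 2)))); last first.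
  by apply: ler_sum => b _; exact: t.
rewrite sumr_const card_ord -[_ *+ _]mulr_natr.
rewrite natr_double1.
have n2 := sqr_ge0 (N%:R : R).
rewrite mulrAC ler_pdivlMr; first by nra.
lra.
Qed.

End Lattice.

(** * Total error over the lattice *)

Section LatticeWeight.
Variable R : realType.
Implicit Types (z w u v : R[i]) (N M n a b s t : nat).
Local Notation ker := (@cauchy_kernel R).

(** A square root in place of the logarithm is small enough after rescaling, and its induction step
    is elementary: for [y ^+ 2 = x ^+ 2 + 1] the inverse of [y ^+ 2] is at most [2 * (y - x)]. *)
Lemma harmonic_le_sqrt M : \sum_(t < M) (1 + t%:R)^-1 <= 2 * Num.sqrt M%:R :> R.
Proof.
elim: M => [|M IH]; first by rewrite big_ord0 sqrtr0 mulr0.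
rewrite big_ord_recr /=.
have x0 := sqrtr_ge0 (M%:R : R); have y0 := sqrtr_ge0 (M.+1%:R : R).
have x2 : Num.sqrt M%:R ^+ 2 = M%:R :> R by rewrite sqr_sqrtr.
have y2 : Num.sqrt M.+1%:R ^+ 2 = M.+1%:R :> R by rewrite sqr_sqrtr.
have -> : 1 + M%:R = Num.sqrt M.+1%:R ^+ 2 :> R by rewrite y2 -natr1 addrC.
have {y2}yx : Num.sqrt M.+1%:R ^+ 2 = Num.sqrt M%:R ^+ 2 + 1 :> R.
  by rewrite x2 y2 -natr1.
move: IH x0 y0 yx; move: (Num.sqrt M%:R) (Num.sqrt M.+1%:R) (\sum_(i < M) _) => x y S IH x0 y0 yx.
have y1 : 1 <= y by clear -x0 y0 yx; nra.
suff : (y ^+ 2)^-1 <= 2 * (y - x) by lra.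
have xy : x <= y by clear -x0 y0 yx; nra.
rewrite -div1r ler_pdivrMr ?exprn_gt0 //; last lra.
have e1 : 1 = (y - x) * (y + x) by rewrite -subr_sqr yx; ring.
rewrite [leLHS]e1 -mulrA mulrCA ler_wpM2l //; first lra.
have : y * 1 <= y ^+ 2 by rewrite expr2 ler_wpM2l.
lra.
Qed.

(** Each term is at most 6 times the difference of the inverses of [1 + s + t] and [2 + s + t], and
    these differences telescope. *)
Lemma sum_inv_sqr_le (s M : nat) :
  \sum_(t < M) (1 + s%:R ^+ 2 + t%:R ^+ 2)^-1 <= 6 / (1 + s%:R) :> R.
Proof.
pose F t : R := - (1 + s%:R + t%:R)^-1.
have s0 : 0 <= s%:R :> R by [].
apply: (@le_trans _ _ (6 * \sum_(0 <= t < M) (F t.+1 - F t))).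
  rewrite big_mkord mulr_sumr; apply: ler_sum => t _.
  have t0 : 0 <= (t : nat)%:R :> R by [].
  rewrite /F opprK -(natr1 t); move: (t%:R : R) (s%:R : R) t0 s0 => {F}y x y0 x0.
  have -> : 6 * (- (1 + x + (y + 1))^-1 + (1 + x + y)^-1) =
      6 / ((1 + x + (y + 1)) * (1 + x + y)).
    by field; apply/andP; split; apply: lt0r_neq0; lra.
  have p0 : 0 < (1 + x + (y + 1)) * (1 + x + y) by rewrite mulr_gt0; lra.
  rewrite -div1r ler_pdivrMr; last by have := sqr_ge0 x; have := sqr_ge0 y; lra.
  rewrite mulrAC ler_pdivlMr // mul1r.
  have := sqr_ge0 (x - y); have := sqr_ge0 (x - 1); have := sqr_ge0 (y - 1); nra.
rewrite telescope_sumr // /F; have : 0 <= (1 + s%:R + M%:R)^-1 :> R.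
  by rewrite invr_ge0 !addr_ge0.
rewrite addr0; lra.
Qed.

Lemma sum2_inv_sqr_le M : \sum_(s < M) \sum_(t < M) (1 + s%:R ^+ 2 + t%:R ^+ 2)^-1
  <= 12 * Num.sqrt M%:R :> R.
Proof.
apply: (@le_trans _ _ (\sum_(s < M) 6 / (1 + s%:R))).
  by apply: ler_sum => s _; exact: sum_inv_sqr_le.
by rewrite -mulr_sumr; have := harmonic_le_sqrt M; lra.
Qed.

(** Cut at [m]: by evenness each half is a part of the sum over [t < M]. *)
Lemma sum_even_shift_le (psi : R -> R) m M : (m < M)%N ->
  (forall x, 0 <= psi x) -> (forall x, psi (- x) = psi x) ->
  \sum_(a < M) psi (a%:R - m%:R) <= 2 * \sum_(t < M) psi t%:R.
Proof.
move=> mM psi0 psiN.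
have widen n : (n <= M)%N -> \sum_(0 <= t < n) psi t%:R <= \sum_(0 <= t < M) psi t%:R.
  move=> nM; rewrite (@big_cat_nat _ _ _ n 0 M) //= lerDl.
  by apply: sumr_ge0 => i _; exact: psi0.
rewrite -(big_mkord xpredT (fun a => psi (a%:R - m%:R))) -(big_mkord xpredT (fun t => psi t%:R)).
rewrite (@big_cat_nat _ _ _ m 0 M) ?(ltnW mM) //=.
have -> : \sum_(m <= a < M) psi (a%:R - m%:R) = \sum_(0 <= t < M - m) psi t%:R.
  rewrite -{1}(add0n m) big_addn; apply: eq_bigr => t _.
  by rewrite natrD addrK.
have -> : \sum_(0 <= a < m) psi (a%:R - m%:R) = \sum_(0 <= t < m) psi t.+1%:R.
  rewrite big_nat_rev /= !big_nat; apply: eq_bigr => t /andP[_ tm].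
  by rewrite add0n natrB // addrAC subrr sub0r psiN.
have h1 := widen _ (leq_subr m M).
have h2 : \sum_(0 <= t < m) psi t.+1%:R <= \sum_(0 <= t < M) psi t%:R.
  apply: le_trans (widen _ mM); rewrite big_nat_recl // lerDr; exact: psi0.
lra.
Qed.

(** Up to the factor 3000 of [PK_approx_ker], this bounds the cost of replacing every kernel of the
    lattice sum by a uniform limit of polynomials. *)
Definition lattice_weight N w : R :=
  \sum_(a < N.*2.+1) \sum_(b < N.*2.+1) (1 + normc (w - lattice_pt R N a b) ^+ 2)^-1.

Lemma lattice_weight_mul_i N w : lattice_weight N ('i%C * w) = lattice_weight N w.
Proof.
rewrite /lattice_weight.
rewrite (lattice_reindex_i (fun c => (1 + normc ('i%C * w - c) ^+ 2)^-1)).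
by apply: eq_bigr => a _; apply: eq_bigr => b _; rewrite -mulrBr normcM normc_i mul1r.
Qed.

Lemma lattice_weight_near N u v : normc (u - v) <= 2 ->
  lattice_weight N u <= 9 * lattice_weight N v.
Proof.
move=> uv; rewrite mulr_sumr; apply: ler_sum => a _.
rewrite mulr_sumr; apply: ler_sum => b _; set c := lattice_pt _ _ _ _.
have hu := ker_den_gt0 (u - c); have hv := ker_den_gt0 (v - c).
rewrite -div1r ler_pdivrMr // mulrAC ler_pdivlMr // mul1r.
have : normc (v - c) <= normc (u - c) + 2.
  by have := normc_triangle3 u v c; rewrite (normc_sub v u); lra.
have := normc_ge0 (u - c); have := normc_ge0 (v - c).
move: (normc (u - c)) (normc (v - c)) => x y y0 x0 yx.
have : y ^+ 2 <= (x + 2) ^+ 2 by rewrite ler_pXn2r ?nnegrE //; lra.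
have := sqr_ge0 (x - 1); nra.
Qed.

Lemma lattice_weight_pt N (k j : nat) : (k <= N)%N -> (j <= N)%N ->
  lattice_weight N (k%:R +i* j%:R)%C <= 48 * Num.sqrt (N.*2.+1)%:R.
Proof.
move=> kN jN; set M := N.*2.+1.
have lt_M k' : (k' <= N -> N + k' < M)%N by rewrite /M -addnn ltnS leq_add2l.
pose q (x y : R) := (1 + x ^+ 2 + y ^+ 2)^-1.
have q0 x y : 0 <= q x y by rewrite invr_ge0 !addr_ge0 ?sqr_ge0.
have -> : lattice_weight N (k%:R +i* j%:R)%C =
    \sum_(a < M) \sum_(b < M) q (a%:R - (N + k)%:R) (b%:R - (N + j)%:R).
  apply: eq_bigr => a _; apply: eq_bigr => b _; rewrite /q normc_sqr /= !natrD.
  by congr (_^-1); ring.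
(* Folding each coordinate onto nonnegative offsets costs a factor 2, whence 48 = 2 * 2 * 12; the
   centre [(N + k, N + j)] lies in range as [k] and [j] are at most [N]. *)
apply: (@le_trans _ _ (\sum_(a < M) 2 * \sum_(t < M) q (a%:R - (N + k)%:R) t%:R)).
  apply: ler_sum => a _; apply: (sum_even_shift_le (psi := q _)) => //.
    exact: lt_M.
  by move=> x; rewrite /q sqrrN.
rewrite -mulr_sumr exchange_big /=.
apply: (@le_trans _ _ (2 * \sum_(t < M) 2 * \sum_(s < M) q s%:R t%:R)).
  rewrite ler_pM2l //; apply: ler_sum => t _.
  apply: (sum_even_shift_le (psi := fun x => q x t%:R)) => //.
    exact: lt_M.
  by move=> x; rewrite /q sqrrN.
rewrite -mulr_sumr exchange_big /=; have := sum2_inv_sqr_le M; rewrite -/q; lra.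
Qed.

Definition lattice_err N w := lattice_sum ker N w - (lattice_const R N)%:C%C * conjc w.

Lemma lattice_err_mul_i N w : lattice_err N ('i%C * w) = - 'i%C * lattice_err N w.
Proof.
rewrite /lattice_err lattice_sum_mul_i.
have -> : conjc ('i%C * w) = - 'i%C * conjc w.
  by case: w => x y; apply/eqP; rewrite eq_complex /=; apply/andP; split; apply/eqP; ring.
by ring.
Qed.

Lemma normc_lattice_err_mul_i N w : normc (lattice_err N ('i%C * w)) = normc (lattice_err N w).
Proof. by rewrite lattice_err_mul_i normcM normc_opp normc_i mul1r. Qed.

(** The quarter turn fixes the origin and multiplies the error by [- 'i%C]. *)
Lemma lattice_err0 N : lattice_err N 0 = 0.
Proof.
have := lattice_err_mul_i N 0; rewrite mulr0 => e.
have {e} : (1 + 'i%C) * lattice_err N 0 = 0.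
  by rewrite mulrDl mul1r {1}e mulNr addNr.
move/eqP; rewrite mulf_eq0 => /orP[|/eqP//].
by rewrite eq_complex /= addr0 oner_eq0.
Qed.

Lemma lattice_err_natD (T : R) N n w : (0 < N)%N -> 2 * T <= N%:R -> normc w + n%:R <= T ->
  normc (lattice_err N (w + n%:R)) <= normc (lattice_err N w) + n%:R * (12 * T / N%:R).
Proof.
move=> N0 TN; elim: n => [|n IH] wT; first by rewrite addr0 mul0r addr0.
rewrite -natr1 in wT.
have {IH}IH := IH ltac:(lra).
have wn : normc (w + n%:R) + 1 <= T.
  by have := normc_triangle w n%:R; rewrite normc_nat; lra.
have := lattice_sum_step N0 (le_trans _ TN : 2 * (normc (w + n%:R) + 1) <= N%:R).
have h2 : 2 * (normc (w + n%:R) + 1) <= 2 * T by lra.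
move=> /(_ h2).
have -> : lattice_sum ker N (w + n%:R + 1) - lattice_sum ker N (w + n%:R) -
    (lattice_const R N)%:C%C = lattice_err N (w + n.+1%:R) - lattice_err N (w + n%:R).
  rewrite /lattice_err -natr1 addrA [conjc (_ + 1)]rmorphD rmorph1; ring.
move=> st.
have : 12 * (normc (w + n%:R) + 1) / N%:R <= 12 * T / N%:R.
  by rewrite ler_wpM2r ?invr_ge0 //; lra.
have := normc_triangle (lattice_err N (w + n.+1%:R) - lattice_err N (w + n%:R))
  (lattice_err N (w + n%:R)).
have -> : n.+1%:R * (12 * T / N%:R) = n%:R * (12 * T / N%:R) + 12 * T / N%:R.
  by rewrite -natr1 mulrDl mul1r.
rewrite subrK; lra.
Qed.

(** Walk from 0 to [j] along the real axis, make a quarter turn, then walk [k] steps to the right;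
    each step adds at most [12 * T / N%:R]. *)
Lemma lattice_err_pt (T : R) N (k j : nat) : (0 < N)%N -> 2 * T <= N%:R -> k%:R + j%:R <= T ->
  normc (lattice_err N (k%:R +i* j%:R)%C) <= T * (12 * T / N%:R).
Proof.
move=> N0 TN kjT; have k0 : 0 <= k%:R :> R by []; have j0 : 0 <= j%:R :> R by [].
have -> : (k%:R +i* j%:R)%C = 'i%C * (0 + j%:R) + k%:R :> R[i].
  rewrite -!(rmorph_nat (real_complex R)); apply/eqP.
  by rewrite eq_complex /=; apply/andP; split; apply/eqP; ring.
apply: le_trans (lattice_err_natD N0 TN _) _.
  by rewrite normcM normc_i mul1r add0r normc_nat; lra.
rewrite normc_lattice_err_mul_i.
have := @lattice_err_natD T N j 0 N0 TN; rewrite normc0 add0r => /(_ ltac:(lra)).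
rewrite lattice_err0 normc0 !add0r => h.
have e0 : 0 <= 12 * T / N%:R by rewrite divr_ge0 //; lra.
have : (k%:R + j%:R) * (12 * T / N%:R) <= T * (12 * T / N%:R) by rewrite ler_wpM2r.
lra.
Qed.

(** Quarter turns bring [w] into the first quadrant, where rounding its coordinates down gives a
    lattice point within 2. Passing to that point costs a factor 9 in the weight (432 = 9 * 48) and
    4 weights in the sum (192 = 4 * 48). *)
Lemma lattice_bounds (T : R) N w : (0 < N)%N -> 2 * T <= N%:R -> 2 * normc w <= T ->
  lattice_weight N w <= 432 * Num.sqrt (N.*2.+1)%:R /\
  normc (lattice_err N w) <= 192 * Num.sqrt (N.*2.+1)%:R + 2 * lattice_const R N +
    T * (12 * T / N%:R).
Proof.
move=> N0 TN.
pose P u := 2 * normc u <= T -> lattice_weight N u <= 432 * Num.sqrt (N.*2.+1)%:R /\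
  normc (lattice_err N u) <= 192 * Num.sqrt (N.*2.+1)%:R + 2 * lattice_const R N +
    T * (12 * T / N%:R).
rewrite -/(P w).
have rot u : P ('i%C * u) -> P u.
  by rewrite /P lattice_weight_mul_i normc_lattice_err_mul_i normcM normc_i mul1r.
have iE x y : 'i%C * (x +i* y)%C = (- y +i* x)%C :> R[i].
  by apply/eqP; rewrite eq_complex /=; apply/andP; split; apply/eqP; ring.
have quad1 x y : 0 <= x -> 0 <= y -> P (x +i* y)%C.
  move=> x0 y0 wT; set u := (x +i* y)%C in wT *.
  have /andP[k1 k2] := truncn_itv x0; have /andP[j1 j2] := truncn_itv y0.
  set k := Num.truncn x in k1 k2; set j := Num.truncn y in j1 j2.
  rewrite -natr1 in k2; rewrite -natr1 in j2.
  have xu : x <= normc u by have := Re_le_normc u; rewrite ger0_norm.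
  have yu : y <= normc u by have := Im_le_normc u; rewrite ger0_norm.
  have kN : (k <= N)%N by rewrite -(ler_nat R); lra.
  have jN : (j <= N)%N by rewrite -(ler_nat R); lra.
  pose v : R[i] := (k%:R +i* j%:R)%C.
  have uv : normc (u - v) <= 2.
    apply: le_trans (normc_le_ReIm _) _; rewrite /= !ger0_norm; lra.
  have wv : lattice_weight N v <= 48 * Num.sqrt (N.*2.+1)%:R by exact: lattice_weight_pt.
  split; first by have := lattice_weight_near N uv; lra.
  have ev : normc (lattice_err N v) <= T * (12 * T / N%:R).
    by apply: lattice_err_pt => //; lra.
  have sv : normc (lattice_sum ker N u - lattice_sum ker N v) <= 4 * lattice_weight N v.
    rewrite /lattice_sum -sumrB; apply: le_trans (normc_sum _ _ _) _.
    rewrite mulr_sumr; apply: ler_sum => a _.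
    rewrite -sumrB; apply: le_trans (normc_sum _ _ _) _.
    rewrite mulr_sumr; apply: ler_sum => b _; apply: ker_sub_near.
    by have -> : forall c, u - c - (v - c) = u - v by move=> c; ring.
  have c1 := lattice_const_ge1 R N0.
  have cv : normc ((lattice_const R N)%:C%C * conjc (u - v)) <= lattice_const R N * 2.
    rewrite normcM normc_real normc_conj ger0_norm; last lra.
    by apply: ler_wpM2l => //; lra.
  have -> : lattice_err N u = lattice_err N v + (lattice_sum ker N u - lattice_sum ker N v)
      - (lattice_const R N)%:C%C * conjc (u - v).
    by rewrite /lattice_err [conjc (u - v)]rmorphB /=; ring.
  have := normc_triangleB (lattice_err N v + (lattice_sum ker N u - lattice_sum ker N v))
    ((lattice_const R N)%:C%C * conjc (u - v)).
  have := normc_triangle (lattice_err N v) (lattice_sum ker N u - lattice_sum ker N v).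
  lra.
have quad4 x y : 0 <= x -> y <= 0 -> P (x +i* y)%C.
  by move=> x0 y0; apply: rot; rewrite iE; apply: quad1; rewrite ?oppr_ge0.
have quad3 x y : x <= 0 -> y <= 0 -> P (x +i* y)%C.
  by move=> x0 y0; apply: rot; rewrite iE; apply: quad4; rewrite ?oppr_ge0.
have quad2 x y : x <= 0 -> 0 <= y -> P (x +i* y)%C.
  by move=> x0 y0; apply: rot; rewrite iE; apply: quad3; rewrite ?oppr_le0.
case: w => x y; have [x0|/ltW x0] := leP 0 x; have [y0|/ltW y0] := leP 0 y; auto.
Qed.

End LatticeWeight.

(** * Approximation of the conjugate *)

Section Conjugate.
Variable R : realType.
Implicit Types (K : set R[i]) (t : R) (n : nat).

(** The kernel estimates are made at mesh 1; mesh [t] is reached by applying them to [K] enlarged by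
    the factor [t^-1]. *)
Lemma lavrentiev_set_scale K t : 0 < t -> lavrentiev_set K ->
  lavrentiev_set (fun w => K (t%:C%C * w)).
Proof.
move=> t0 LK; have tn x : normc (t%:C%C * x) = t * normc x.
  by rewrite normcM normc_real gtr0_norm.
have tC : t%:C%C != 0 :> R[i] by rewrite -normc_gt0 normc_real normr_gt0 lt0r_neq0.
split.
- have [M HM] := lav_bounded LK; exists (M / t) => z Kz.
  by rewrite ler_pdivlMr // mulrC -tn HM.
- move=> a Ka; have [r r0 Hr] := lav_closed LK Ka.
  exists (r / t); first by rewrite divr_gt0.
  move=> z Kz; rewrite ler_pdivrMr // mulrC -tn mulrBr; exact: Hr.
- move=> c r r0; have [|a Ka ac] := lav_thin LK (t%:C%C * c) (r := t * r).
    by rewrite mulr_gt0.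
  exists (a / t%:C%C); first by rewrite mulrC divfK.
  by rewrite -(ltr_pM2l t0) -tn mulrBr [_ * (a / _)]mulrC divfK.
- move=> P [b Kb Pb] loc.
  suff H : forall b, ~ K b -> P (b / t%:C%C).
    by move=> b' Kb'; have := H _ Kb'; rewrite mulrC mulKf.
  apply: (lav_connected LK).
    by exists (t%:C%C * b) => //; rewrite mulrC mulKf.
  move=> a Ka; have [|r r0 Hr] := loc (a / t%:C%C); first by rewrite mulrC divfK.
  exists (t * r); first by rewrite mulr_gt0.
  move=> b' Kb' ab; apply: Hr; first by rewrite mulrC divfK.
  by rewrite -mulrBl -(ltr_pM2l t0) -tn mulrC divfK.
Qed.

Lemma PK_scale_arg K t f : t != 0 ->
  uniform_limit_of_polys (fun w => K (t%:C%C * w)) f ->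
  uniform_limit_of_polys K (fun z => f (z / t%:C%C)).
Proof.
move=> t0 Pf e e0; have [p Hp] := Pf e e0.
have tC : t%:C%C != 0 :> R[i] by rewrite -normc_gt0 normc_real normr_gt0.
exists (p \Po ((t%:C%C)^-1 *: 'X)) => z Kz.
rewrite horner_comp hornerZ hornerX [_^-1 * z]mulrC; apply: Hp.
by rewrite mulrC divfK.
Qed.

(** With [x] the approximating sum and [y] the lattice sum, the error splits into the lattice error
    and the kernel errors. *)
Lemma conj_rescale t c (w x y : R[i]) : c != 0 ->
  conjc (t%:C%C * w) - (t / c)%:C%C * x =
  (t / c)%:C%C * - ((y - c%:C%C * conjc w) + (x - y)).
Proof.
move=> c0; have cC : c%:C%C != 0 :> R[i] by rewrite -normc_gt0 normc_real normr_gt0.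
have -> : conjc (t%:C%C * w) = t%:C%C * conjc w.
  by case: w => a b; apply/eqP; rewrite eq_complex /=; apply/andP; split; apply/eqP; ring.
rewrite (rmorphM (real_complex R)) (fmorphV (real_complex R)).
rewrite /=.
move: cC; move: (t%:C)%C (c%:C)%C (conjc w) => T C W C0.
by field.
Qed.

(** The real arithmetic that ends [PK_conj]. A large [B] controls the boundary term, equal to
    [48 * M ^+ 2 / B * n]; a large [r] controls the terms in [sq], of order [B * r] against
    [n = B * r ^+ 2], and also [2 * c]. Each of the three is at most [e / 4 * n * c]. *)
Lemma rescaling_bound (e M B r n N c Q sq wt : R) (x y : R[i]) :
  0 < e -> 1 <= B -> 1 <= r -> 1 <= c -> 4 * M + 192 * M ^+ 2 / e < B -> 1 <= M ->
  Q = 2 * (192 + 3000 * 432) -> 4 * Q / e < r -> n = B * r ^+ 2 -> N = B * n ->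
  sq <= 2 * (B * r) -> wt <= 432 * sq ->
  normc x <= 192 * sq + 2 * c + 2 * n * M * (12 * (2 * n * M) / N) ->
  normc y <= 3000 * wt -> n^-1 / c * normc (x + y) < e.
Proof.
move=> e0 B1 r1 c1 HB M1 HQ Hr nE NE sqE wtE xE yE.
have n_ge_r : r <= n by rewrite nE; clear -B1 r1; nra.
have n0 : 0 < n by clear -n_ge_r r1; lra.
have T2 : 2 * n * M * (12 * (2 * n * M) / N) = 48 * M ^+ 2 / B * n.
  by rewrite NE; field; rewrite !lt0r_neq0 //; clear -B1; lra.
have h1 : 48 * M ^+ 2 / B <= e / 4.
  rewrite ler_pdivrMr; last by clear -B1; lra.
  have : 192 * M ^+ 2 / e < B by clear -HB M1; lra.
  by rewrite ltr_pdivrMr // => h; clear -h; lra.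
have h2 : Q <= e / 4 * r by move: Hr; rewrite ltr_pdivrMr // => h; clear -h; lra.
have Br0 : 0 <= B * r by rewrite mulr_ge0; clear -B1 r1; lra.
have h3 : Q * (B * r) <= e / 4 * n.
  have -> : e / 4 * n = e / 4 * r * (B * r) by rewrite nE; ring.
  by rewrite ler_wpM2r.
have h4 : 2 <= e / 4 * n.
  have : e / 4 * r <= e / 4 * n by rewrite ler_wpM2l //; clear -e0; lra.
  move=> h; clear -h h2 HQ; lra.
have h5 : 48 * M ^+ 2 / B * n <= e / 4 * n by rewrite ler_wpM2r // ltW.
rewrite T2 in xE.
apply: (@le_lt_trans _ _ (n^-1 / c * (3 * (e / 4 * n) * c))); last first.
  have -> : n^-1 / c * (3 * (e / 4 * n) * c) = 3 / 4 * e.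
    by field; rewrite !lt0r_neq0 //; clear -c1; lra.
  by clear -e0; lra.
apply: ler_wpM2l; first by rewrite mulr_ge0 ?invr_ge0; clear -n0 c1; lra.
apply: le_trans (normc_triangle _ _) _.
have {}h3 : (192 + 3000 * 432) * sq <= e / 4 * n.
  apply: le_trans h3; rewrite HQ; clear -sqE; lra.
have {}xE : normc x + normc y <= (192 + 3000 * 432) * sq + 2 * c + 48 * M ^+ 2 / B * n.
  clear -xE yE wtE; lra.
apply: le_trans xE _; move: (e / 4 * n) h3 h4 h5 => E h3 h4 h5.
have E0 : 0 <= E by clear -h4; lra.
have h7 : E * 1 <= E * c by rewrite ler_wpM2l.
have h8 : 2 * c <= E * c by rewrite ler_wpM2r //; clear -c1; lra.
by clear -h3 h5 h7 h8; lra.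
Qed.

Lemma PK_conj K : lavrentiev_set K -> uniform_limit_of_polys K (@conjc R).
Proof.
move=> LK; apply: PK_lim => e e0.
have [M0 HM0] := lav_bounded LK.
pose M := `|M0| + 1.
have M1 : 1 <= M by rewrite /M lerDr.
have HM z : K z -> normc z <= M.
  by move=> /HM0 h; have := ler_norm M0; rewrite /M; lra.
have M20 : 0 <= M ^+ 2 := sqr_ge0 _.
pose B := Num.bound (4 * M + 192 * M ^+ 2 / e).
have eM0 : 0 <= 192 * M ^+ 2 / e by apply: divr_ge0; [exact: mulr_ge0 | exact: ltW].
have HB : 4 * M + 192 * M ^+ 2 / e < B%:R by apply: archi_boundP; lra.
have [Q HQ] : exists Q : R, Q = 2 * (192 + 3000 * 432) by exists (2 * (192 + 3000 * 432)).
have Q2 : 2 <= Q by rewrite HQ; lra.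
pose r := Num.bound (4 * Q / e).
have Q4 : 0 <= 4 * Q / e by apply: divr_ge0; [lra | exact: ltW].
have Hr : 4 * Q / e < r%:R by exact: archi_boundP.
have r0 : 0 < r%:R :> R by exact: le_lt_trans Hr.
have B0 : 1 <= B%:R :> R by lra.
have r1 : 1 <= r%:R :> R by rewrite ler1n -(ltr0n R).
(* The mesh is [1 / n] and the half side of the square is [N / n = B], beyond [4 * M]. As [N] is the
   square of [B * r], the root of [2 * N + 1] is at most [2 * B * r]. *)
pose n := (B * r ^ 2)%N; pose N := (B * n)%N.
have nE : n%:R = B%:R * r%:R ^+ 2 :> R by rewrite natrM natrX.
have NE : N%:R = B%:R * n%:R :> R by rewrite natrM.
have n_ge_r : r%:R <= n%:R :> R.
  by rewrite nE; have : r%:R * 1 <= r%:R * r%:R :> R; [rewrite ler_wpM2l// ltW | clear -B0 r1; nra].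
have n0 : 0 < n%:R :> R by exact: lt_le_trans n_ge_r.
have N0 : (0 < N)%N by rewrite -(ltr0n R) NE mulr_gt0 //; lra.
pose t : R := n%:R^-1.
have t0 : 0 < t by rewrite invr_gt0.
have LKt := lavrentiev_set_scale t0 LK.
have [g Hg] := boolp.choice (fun c => let: ex_intro2 g P Q := PK_approx_ker LKt c in
  ex_intro _ g (conj P Q)).
pose c := lattice_const R N; have c1 : 1 <= c := lattice_const_ge1 R N0.
pose G w := \sum_(a < N.*2.+1) \sum_(b < N.*2.+1) g (lattice_pt R N a b) w.
exists (fun z => (t / c)%:C%C * G (z / t%:C%C)).
  apply: PK_scale; first exact: lav_bounded LK.
  apply: PK_scale_arg; first exact: lt0r_neq0.
  by apply: PK_sum => a; apply: PK_sum => b; have [] := Hg (lattice_pt R N a b).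
move=> z Kz; set w := z / t%:C%C.
have tC : t%:C%C != 0 :> R[i] by rewrite -normc_gt0 normc_real normr_gt0 lt0r_neq0.
have Kw : K (t%:C%C * w) by rewrite /w mulrC divfK.
have wM : 2 * normc w <= 2 * n%:R * M.
  rewrite normc_div normc_real gtr0_norm // /t invrK -mulrA ler_pM2l // mulrC.
  by rewrite ler_pM2l // HM.
have TN : 2 * (2 * n%:R * M) <= N%:R.
  rewrite NE; have : 4 * M * n%:R <= B%:R * n%:R by rewrite ler_pM2r //; clear -HB eM0; lra.
  clear; lra.
have [wtE er] := lattice_bounds N0 TN wM.
have gk : normc (G w - lattice_sum (@cauchy_kernel R) N w) <= 3000 * lattice_weight N w.
  rewrite -sumrB; apply: le_trans (normc_sum _ _ _) _.
  rewrite mulr_sumr; apply: ler_sum => a _.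
  rewrite -sumrB; apply: le_trans (normc_sum _ _ _) _.
  rewrite mulr_sumr; apply: ler_sum => b _.
  by have [_ H] := Hg (lattice_pt R N a b); exact: H.
have sq : Num.sqrt (N.*2.+1)%:R <= 2 * (B%:R * r%:R) :> R.
  have -> : 2 * (B%:R * r%:R) = Num.sqrt ((2 * (B%:R * r%:R)) ^+ 2) :> R.
    by rewrite sqrtr_sqr ger0_norm // !mulr_ge0.
  rewrite ler_sqrt ?sqr_ge0 // natr_double1.
  have -> : (2 * (B%:R * r%:R)) ^+ 2 = 4 * N%:R :> R by rewrite NE nE; ring.
  by have : 1 <= N%:R :> R; [rewrite ler1n | clear; lra].
have -> : conjc z - (t / c)%:C%C * G w =
    (t / c)%:C%C * - (lattice_err N w + (G w - lattice_sum (@cauchy_kernel R) N w)).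
  rewrite -conj_rescale; last by apply: lt0r_neq0; exact: lt_le_trans c1.
  by rewrite [t%:C%C * w]mulrC /w divfK.
rewrite normcM normc_opp normc_real ger0_norm; last first.
  by rewrite divr_ge0 // ltW // (lt_le_trans ltr01).
exact: (@rescaling_bound e M B%:R r%:R n%:R N%:R c Q _ _ _ _ e0 B0 r1 c1 HB M1 HQ Hr
  nE NE sq wtE er gk).
Qed.

End Conjugate.

(** * Stone-Weierstrass *)

Section StoneWeierstrass.
Variable R : realType.
Variable K : set R[i].
Hypothesis bndK : exists M : R, forall z, K z -> normc z <= M.
Hypothesis conjK : uniform_limit_of_polys K (@conjc R).
Implicit Types (u v : R[i] -> R) (a b e : R).
Local Notation PK := (uniform_limit_of_polys K).
Local Notation PKr u := (PK (fun z => (u z)%:C%C)).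

Lemma PKr_Re : PKr (@complex.Re R).
Proof.
apply: PK_ext (PK_scale bndK (2^-1) (PK_add (PK_id K) conjK)) => -[x y] _.
by apply/eqP; rewrite -(rmorph_nat (real_complex R)) -fmorphV eq_complex /=; apply/andP; split; apply/eqP; field.
Qed.

Lemma PKr_Im : PKr (@complex.Im R).
Proof.
apply: PK_ext (PK_scale bndK (- 'i%C * 2^-1) (PK_sub bndK (PK_id K) conjK)) => -[x y] _.
by apply/eqP; rewrite -(rmorph_nat (real_complex R)) -fmorphV eq_complex /=; apply/andP; split; apply/eqP; field.
Qed.

Lemma PKr_cst a : PKr (fun=> a).
Proof. exact: PK_cst. Qed.

Lemma PKr_add u v : PKr u -> PKr v -> PKr (fun z => u z + v z).
Proof. by move=> Pu Pv; apply: PK_ext (PK_add Pu Pv) => z _; rewrite rmorphD. Qed.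

Lemma PKr_mul u v : PKr u -> PKr v -> PKr (fun z => u z * v z).
Proof. by move=> Pu Pv; apply: PK_ext (PK_mul bndK Pu Pv) => z _; rewrite rmorphM. Qed.

Lemma PKr_scale a u : PKr u -> PKr (fun z => a * u z).
Proof. by move=> Pu; apply: PKr_mul => //; exact: PKr_cst. Qed.

Lemma PKr_sub u v : PKr u -> PKr v -> PKr (fun z => u z - v z).
Proof.
move=> Pu Pv; apply: PK_ext (PK_sub bndK Pu Pv) => z _.
by rewrite -rmorphB.
Qed.

Lemma PKr_lim u : (forall e, 0 < e ->
  exists2 v, PKr v & forall z, K z -> `|u z - v z| < e) -> PKr u.
Proof.
move=> H; apply: PK_lim => e /H[v Pv uv].
exists (fun z => (v z)%:C%C) => // z Kz.
by rewrite -rmorphB normc_real uv.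
Qed.

(* The iterates increase to [`|u z|], with error at most [2 / (n + 2)]. *)
Lemma PKr_abs_unit u : PKr u -> (forall z, K z -> `|u z| <= 1) -> PKr (fun z => `|u z|).
Proof.
move=> Pu u1.
pose it n := iter n (fun t z => t z + (u z ^+ 2 - t z ^+ 2) * 2^-1) (fun=> 0 : R).
have Pit n : PKr (it n).
  elim: n => [|n IH] /=; first exact: PKr_cst.
  apply: PKr_add => //; apply: PKr_mul; last exact: PKr_cst.
  by apply: PKr_sub; exact: PKr_mul.
have err n z : K z -> 0 <= it n z /\ 0 <= `|u z| - it n z <= 2 / (n%:R + 2).
  move=> Kz; have := u1 z Kz; have := normr_ge0 (u z).
  elim: n => [|n IH] a0 a1; first by rewrite subr0 add0r divff ?pnatr_eq0 //; split=> //; apply/andP.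
  have {IH}[t0 /andP[d0 d1]] := IH a0 a1.
  have -> : it n.+1 z = it n z + (u z ^+ 2 - it n z ^+ 2) * 2^-1 by [].
  have -> : u z ^+ 2 = `|u z| ^+ 2 by rewrite real_normK ?num_real.
  have n0 : 0 <= n%:R :> R by [].
  rewrite -(natr1 n); move: (n%:R : R) (`|u z|) (it n z) n0 a0 a1 t0 d0 d1 => x a t x0 a0 a1 t0 d0.
  rewrite ler_pdivlMr; last lra.
  move=> d1.
  have e1 : a - (t + (a ^+ 2 - t ^+ 2) * 2^-1) = (a - t) * (1 - (a + t) / 2) by field.
  have d2 : 0 <= (a - t) * (1 - (a + t) / 2) by apply: mulr_ge0; lra.
  (* As [t] is nonnegative, the error [d = a - t] becomes at most [d * (1 - d / 2)], a recursion
     that preserves the bound [2 / (n + 2)]. *)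
  have d3 : (a - t) * (1 - (a + t) / 2) <= (a - t) * (1 - (a - t) / 2).
    by apply: ler_wpM2l; lra.
  split.
    have p0 : 0 <= (a - t) * (a + t) by apply: mulr_ge0; lra.
    by rewrite subr_sqr addr_ge0 // divr_ge0.
  rewrite e1 d2 /= ler_pdivlMr; last lra.
  apply: (@le_trans _ _ ((a - t) * (1 - (a - t) / 2) * (x + 1 + 2))).
    by apply: ler_wpM2r => //; lra.
  have : a - t <= 1 by lra.
  move: (a - t) d0 d1 => d d0 d1 dle; clear -x0 d0 d1 dle.
  have : 0 <= (1 - d) ^+ 2 := sqr_ge0 _.
  have : 0 <= (2 - d * (x + 2)) * d by apply: mulr_ge0; lra.
  nra.
apply: PKr_lim => e e0.
have h0 : 0 <= 2 / e by apply: divr_ge0 => //; exact: ltW.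
have := archi_boundP h0; set n := Num.bound _ => ne.
exists (it n) => // z Kz; have [_ /andP[d0 d1]] := err n z Kz.
rewrite ger0_norm //; apply: le_lt_trans d1 _.
rewrite ltr_pdivrMr; last by lra.
by move: ne; rewrite ltr_pdivrMr // => ne; clear -ne e0; lra.
Qed.

Lemma PKr_abs u : PKr u -> PKr (fun z => `|u z|).
Proof.
move=> Pu; have [B B0 HB] := PK_bounded bndK Pu.
have P1 : PKr (fun z => `|B^-1 * u z|).
  apply: PKr_abs_unit; first exact: PKr_scale.
  move=> z Kz; rewrite normrM normfV (gtr0_norm B0) mulrC ler_pdivrMr // mul1r.
  by have := HB z Kz; rewrite normc_real.
apply: PK_ext (PKr_scale B P1) => z _.
by rewrite normrM normfV (gtr0_norm B0) mulVKf // lt0r_neq0.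
Qed.

Lemma PKr_min u v : PKr u -> PKr v -> PKr (fun z => Num.min (u z) (v z)).
Proof.
move=> Pu Pv.
have P := PKr_scale 2^-1 (PKr_sub (PKr_add Pu Pv) (PKr_abs (PKr_sub Pu Pv))).
apply: PK_ext P => z _; congr (_%:C)%C.
by have [uv|uv] := leP (u z) (v z);
  [rewrite ler0_norm ?subr_le0 // | rewrite gtr0_norm ?subr_gt0 //]; field.
Qed.

Lemma PKr_min_seq (I : eqType) (phi : I -> R[i] -> R) i s : (forall j, PKr (phi j)) ->
  exists u, [/\ PKr u, forall z, exists2 j, j \in i :: s & u z = phi j z
    & forall z j, j \in i :: s -> u z <= phi j z].
Proof.
move=> Pphi; elim: s i => [|j s IH] i.
  exists (phi i); split=> // z; first by exists i; rewrite ?mem_head.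
  by move=> j; rewrite inE => /eqP->.
have [u [Pu um ule]] := IH j.
exists (fun z => Num.min (phi i z) (u z)); split; first exact: PKr_min.
  move=> z; rewrite minEle; case: ifP => _; first by exists i; rewrite ?mem_head.
  by have [k ks uk] := um z; exists k => //; rewrite inE ks orbT.
move=> z k; rewrite inE => /orP[/eqP->|ks]; first by rewrite ge_min lexx.
by rewrite ge_min ule ?orbT.
Qed.

Lemma PKr_l1_dist (c : R[i]) : PKr (fun z => `|Re (z - c)| + `|Im (z - c)|).
Proof.
apply: PKr_add; apply: PKr_abs.
  by apply: PK_ext (PKr_sub PKr_Re (PKr_cst (Re c))) => -[x y] _; case: c.
by apply: PK_ext (PKr_sub PKr_Im (PKr_cst (Im c))) => -[x y] _; case: c.
Qed.

Definition finitely_covered := forall rho : R[i] -> R, (forall c, 0 < rho c) ->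
  exists2 s : seq R[i], (forall c, c \in s -> K c) &
    forall z, K z -> exists2 c, c \in s & normc (z - c) < rho c.

(** The approximant is a lower envelope of finitely many cones [phi c] with apex value [u c]. No
    cone drops below [u - e / 3] on [K]: near [c] by continuity, and beyond [eta c] because the
    slope [L c] has lifted it by [2 * B]. The covering radius keeps the cone of a centre close to
    [z] below [u z + e]. *)
Lemma PKr_continuous u : finitely_covered ->
  (exists2 B, 0 < B & forall z, K z -> `|u z| <= B) ->
  (forall c e, K c -> 0 < e -> exists2 eta, 0 < eta &
     forall z, K z -> normc (z - c) < eta -> `|u z - u c| < e) ->
  PKr u.
Proof.
move=> covK [B B0 HB] uc; apply: PKr_lim => e e0.
have e30 : 0 < e / 3 by lra.
have /boolp.choice[eta Heta] : forall c, exists t : R, 0 < t /\ (K c ->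
    forall z, K z -> normc (z - c) < t -> `|u z - u c| < e / 3).
  move=> c; have [Kc|nKc] := pselect (K c); last by exists 1.
  by have [t t0 Ht] := uc c _ Kc e30; exists t.
pose L c := 2 * B / eta c.
have eta0 c : 0 < eta c by have [] := Heta c.
have L0 c : 0 < L c by rewrite divr_gt0 // mulr_gt0.
pose rho c := Num.min (eta c) (e / 3 / (2 * L c)).
have rho0 c : 0 < rho c by rewrite lt_min eta0 divr_gt0 // mulr_gt0.
have [[|c0 s] sK cov] := covK rho rho0.
  by exists (fun=> 0); [exact: PKr_cst | move=> z /cov[]].
pose phi c z := u c + L c * (`|Re (z - c)| + `|Im (z - c)|).
have Pphi c : PKr (phi c).
  by apply: PKr_add; [exact: PKr_cst | apply: PKr_scale; exact: PKr_l1_dist].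
have [F [PF Fm Fle]] := PKr_min_seq c0 s Pphi.
exists F => // z Kz; rewrite distrC ltr_norml.
have close c : K c -> normc (z - c) < eta c -> `|u z - u c| < e / 3.
  by move=> Kc; have [_ /(_ Kc)] := Heta c; apply.
apply/andP; split.
  have [c cs ->] := Fm z; have Kc := sK c cs.
  have l1 := normc_le_ReIm (z - c).
  rewrite /phi; have [far|near] := leP (eta c) (normc (z - c)).
    have : L c * eta c <= L c * (`|Re (z - c)| + `|Im (z - c)|).
      by rewrite ler_pM2l //; lra.
    rewrite /L divfK ?lt0r_neq0 //.
    have := HB z Kz; have := HB c Kc; rewrite !ler_norml => /andP[h1 h2] /andP[h3 h4] h5.
    by clear -h1 h2 h3 h4 h5 e0; lra.
  have : 0 <= L c * (`|Re (z - c)| + `|Im (z - c)|) by rewrite mulr_ge0 ?addr_ge0 // ltW.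
  have := close c Kc near; rewrite ltr_norml => /andP[h1 h2] h3.
  by clear -h1 h2 h3 e0; lra.
have [c cs zc] := cov z Kz; have Kc := sK c cs.
move: zc; rewrite lt_min => /andP[near]; rewrite ltr_pdivlMr; last exact: mulr_gt0 (L0 c).
move=> h.
have := close c Kc near; rewrite ltr_norml => /andP[h1 h2].
have h3 := Fle z c cs; rewrite /phi in h3.
have h4 : L c * (`|Re (z - c)| + `|Im (z - c)|) <= L c * (2 * normc (z - c)).
  rewrite ler_pM2l //; have := Re_le_normc (z - c); have := Im_le_normc (z - c).
  by clear; lra.
by clear -h h1 h2 h3 h4 e0; lra.
Qed.

End StoneWeierstrass.

(** * Topology of the complex plane *)

(** Presents row vectors as a complete normed space, the setting in which Baire's theorem is applied
    below. *)
HB.instance Definition _ (R : realType) (n : nat) := Complete.on 'rV[R]_n.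

Section PlaneTopology.
Variable R : realType.
Implicit Types (K E : set (Cplane R)) (p q : {poly R[i]}).

Lemma nbhs_normcP (x : Cplane R) (P : set (Cplane R)) :
  nbhs x P <-> exists2 r : R, 0 < r & forall y, normc (y - x) < r -> P y.
Proof.
split=> [/nbhs_normP[e /= e0 He]|[r r0 Hr]].
  move: e0; rewrite ltcE /= => /andP[/eqP e0 Re0].
  exists (Re e) => // y yx; apply: He => /=.
  rewrite distrC -[ltLHS]/((normc (y - x))%:C)%C ltcE /=.
  by rewrite e0 eqxx yx.
apply/nbhs_ballP; exists (r%:C)%C => /=; first by rewrite ltcR.
move=> y; rewrite -ball_normE /= => xy; apply: Hr; rewrite -ltcR; move: xy; rewrite distrC.
by rewrite -[X in X < _]/((normc (y - x))%:C)%C.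
Qed.

Lemma open_normcP (U : set (Cplane R)) : open U <->
  forall x, U x -> exists2 r : R, 0 < r & forall y, normc (y - x) < r -> U y.
Proof.
rewrite openE; split=> H x Ux; first by apply/nbhs_normcP; exact: H.
by apply/nbhs_normcP; exact: H.
Qed.

Lemma open_normc_ball (c : Cplane R) (r : R) : open [set z : Cplane R | normc (z - c) < r].
Proof.
apply/open_normcP => x /= xc; exists (r - normc (x - c)); first by rewrite subr_gt0.
by move=> y yx; have := normc_triangle3 x y c; lra.
Qed.

Lemma compact_finitely_covered K : compact K -> finitely_covered K.
Proof.
rewrite compact_cover => cK rho rho0.
have [|z Kz|D DK KD] := cK (Cplane R) K (fun c => [set z | normc (z - c) < rho c]).
- by move=> c _; exact: open_normc_ball.
- by exists z => //=; rewrite subrr normc0.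
exists (finmap.enum_fset D) => [c cD|z Kz].
  by have := DK c cD; rewrite inE.
by have [c /= cD zc] := KD z Kz; exists c.
Qed.

Lemma finitely_covered_bounded K (F : R[i] -> R) : finitely_covered K ->
  (forall c, K c -> exists2 eta : R, 0 < eta &
     forall z, K z -> normc (z - c) < eta -> `|F z - F c| < 1) ->
  exists2 B : R, 0 < B & forall z, K z -> `|F z| <= B.
Proof.
move=> covK Fc.
have /boolp.choice[eta Heta] : forall c, exists t : R, 0 < t /\ (K c ->
    forall z, K z -> normc (z - c) < t -> `|F z - F c| < 1).
  move=> c; have [Kc|nKc] := pselect (K c); last by exists 1.
  by have [t t0 Ht] := Fc c Kc; exists t.
have [s sK cov] := covK eta (fun c => proj1 (Heta c)).
have [B B0 HB] : exists2 B : R, 0 < B & forall c, c \in s -> `|F c| <= B.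
  elim: s {sK cov} => [|c s [B B0 HB]]; first by exists 1.
  exists (B + `|F c|); first by rewrite ltr_pwDl.
  move=> d; rewrite inE => /orP[/eqP->|/HB]; first by rewrite lerDr ltW.
  by have := normr_ge0 (F c); lra.
exists (B + 1) => [|z Kz]; first lra.
have [c cs zc] := cov z Kz.
have h1 := (proj2 (Heta c)) (sK c cs) z Kz zc; have h2 := HB c cs.
by have := ler_normD (F z - F c) (F c); rewrite subrK; lra.
Qed.

Lemma compact_lavrentiev_set K : compact K -> connected (~` K) -> interior K = set0 ->
  lavrentiev_set K.
Proof.
move=> cK conK intK; have covK := compact_finitely_covered cK.
have clK : open (~` K).
  by rewrite openC; apply: compact_closed => //; exact: norm_hausdorff.
split.
- have [|B B0 HB] := finitely_covered_bounded (F := fun z => normc z) covK.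
    move=> c Kc; exists 1 => // z Kz zc; rewrite ltr_norml.
    have := normc_subr_ge z c; have := normc_subr_ge c z; rewrite (normc_sub c z); lra.
  by exists B => z Kz; exact: le_trans (ler_norm _) (HB z Kz).
- move=> a Ka; have [r r0 Hr] := (open_normcP _).1 clK a Ka.
  by exists r => // z Kz; rewrite leNgt; apply/negP => /Hr.
- move=> c r r0; apply: contrapT => H.
  have : interior K c.
    apply/nbhs_normcP; exists r => // y yc; apply: contrapT => Ky.
    by apply: H; exists y.
  by rewrite intK.
- move=> P [b Kb Pb] loc.
  (* Applied to [P] and to its negation, this makes the part of the complement where [P] holds both
     relatively open and relatively closed. *)
  have loc_open (Q : R[i] -> Prop) : (forall a, ~ K a -> exists2 r : R, 0 < r &
      forall b, ~ K b -> normc (b - a) < r -> Q a -> Q b) -> open (~` K `&` Q).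
    move=> locQ; apply/open_normcP => x [/= Kx Qx].
    have [r r0 Hr] := (open_normcP _).1 clK x Kx.
    have [r' r'0 Hr'] := locQ x Kx.
    exists (Num.min r r'); first by rewrite lt_min r0.
    move=> y; rewrite lt_min => /andP[yr yr'].
    by have nKy := Hr y yr; split=> //; exact: Hr' Qx.
  have o1 : open (~` K `&` P).
    apply: loc_open => a Ka; have [r r0 Hr] := loc a Ka.
    by exists r => // b' Kb' ab' Pa; apply/(Hr b' Kb' ab').
  have o2 : open (~` K `&` ~` P).
    apply: loc_open => a Ka; have [r r0 Hr] := loc a Ka.
    by exists r => // b' Kb' ab' Pa Pb'; apply: Pa; apply/(Hr b' Kb' ab').
  have e : ~` K `&` P = ~` K.
    apply: conK; first by exists b.
      by exists (~` K `&` P) => //; rewrite setIA setIid.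
    exists (~` (~` K `&` ~` P)); first by rewrite closedC.
    rewrite setCI !setCK setIUr setICl set0U.
    by [].
  by move=> b' Kb'; have : (~` K `&` P) b' by [rewrite e]; case.
Qed.

Lemma within_continuous_normc K (f : Cplane R -> Cplane R) :
  {within K, continuous f} -> forall c (e : R), K c -> 0 < e ->
  exists2 eta : R, 0 < eta &
    forall z, K z -> normc (z - c) < eta -> normc (f z - f c) < e.
Proof.
move=> /subspace_continuousP cf c e Kc e0.
have : nbhs (f c) [set w : Cplane R | normc (w - f c) < e].
  by apply/nbhs_normcP; exists e.
move=> /(cf c Kc) /= /nbhs_normcP[r r0 Hr].
by exists r => // z Kz zc; exact: Hr.
Qed.

Lemma normc_within_continuous K (g : Cplane R -> R) :
  (forall c (e : R), K c -> 0 < e -> exists2 eta : R, 0 < eta &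
    forall z, K z -> normc (z - c) < eta -> `|g z - g c| < e) ->
  {within K, continuous g}.
Proof.
move=> H; apply/subspace_continuousP => c Kc.
apply/cvgrPdist_lt => e e0; have [r r0 Hr] := H c e Kc e0.
apply/nbhs_normcP; exists r => // z zc Kz.
by rewrite distrC; exact: Hr.
Qed.

Lemma poly_lipschitz p (M : R) : exists2 L : R, 0 < L &
  forall z w, normc z <= M -> normc w <= M -> normc (p.[z] - p.[w]) <= L * normc (z - w).
Proof.
elim/poly_ind: p => [|p c [L L0 HL]].
  by exists 1 => // z w _ _; rewrite !horner0 subrr normc0 mul1r normc_ge0.
have [|B B0 HB] := @poly_bounded R [set z | normc z <= M] _ p; first by exists M.
have M0 := normr_ge0 M; have LM0 : 0 <= L * `|M| by rewrite mulr_ge0 // ltW.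
exists (B + L * `|M|); first lra.
move=> z w zM wM; rewrite !hornerMXaddC.
have -> : p.[z] * z + c - (p.[w] * w + c) = p.[z] * (z - w) + (p.[z] - p.[w]) * w by ring.
apply: le_trans (normc_triangle _ _) _; rewrite !normcM mulrDl lerD //.
  by rewrite ler_wpM2r ?normc_ge0 // HB.
rewrite mulrAC ler_pM ?normc_ge0 ?HL //.
exact: le_trans wM (ler_norm _).
Qed.

(** * Translations that move a countable set off [K] *)

Lemma exists_translate_avoiding K E (del : R) : lavrentiev_set K ->
  countable E -> 0 < del ->
  exists2 t : R[i], normc t < del & forall e, E e -> ~ K (e - t).
Proof.
move=> LK /countable_injP[g ginj] del0.
(* The plane is normed over [R[i]]; Baire's theorem is used over [R], in ['rV[R]_2], which [C] and
   [V] identify with the plane. *)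
pose C (v : 'rV[R]_2) : R[i] := (v 0 0 +i* v 0 1)%C.
pose V (z : R[i]) : 'rV[R]_2 := \row_(j < 2) (if j == 0 then Re z else Im z).
have VK z : C (V z) = z by case: z => x y; rewrite /C !mxE.
have CB v w : C (v - w) = C v - C w.
  by apply/eqP; rewrite eq_complex /= !mxE !eqxx.
have C_le v : normc (C v) <= 2 * `|v|.
  apply: le_trans (normc_le_ReIm _) _ => /=.
  have h j : `|v 0 j| <= `|v|.
    rewrite [leRHS]mx_normrE; exact: (le_bigmax _ (fun ij => `|v ij.1 ij.2|) (0, j)).
  by have := h 0; have := h 1; lra.
have V_lt v (r : R) : 0 < r -> normc (C v) < r -> `|v| < r.
  move=> r0 vr; rewrite [ltLHS]mx_normrE; apply: bigmax_lt => // -[i j] _ /=.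
  rewrite (ord1 i); case: j => -[|[|//]] h; apply: le_lt_trans vr.
    by apply: le_trans (Re_le_normc (C v)) => /=; rewrite (_ : Ordinal h = 0) //; exact: val_inj.
  by apply: le_trans (Im_le_normc (C v)) => /=; rewrite (_ : Ordinal h = 1) //; exact: val_inj.
(* By injectivity of [g] at most one [e] has code [n], so [F n] concerns a single point, or is
   everything when [n] codes none. *)
pose F (n : nat) := [set v : 'rV[R]_2 | forall e, E e -> g e = n -> ~ K (e - C v)].
have F1 n e v : E e -> g e = n -> ~ K (e - C v) -> F n v.
  move=> Ee gen Kev e' Ee' ge'n.
  by rewrite (ginj e' e) ?inE // ge'n.
have odF n : open (F n) /\ dense (F n).
  have [[e [Ee gen]]|noE] := pselect (exists e, E e /\ g e = n); last first.
    have -> : F n = setT.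
      by apply/seteqP; split=> // v _ e Ee gen; case: noE; exists e.
    by split; [exact: openT | move=> O [v Ov] _; exists v].
  split.
    rewrite openE => v /= Fv; have [r r0 Hr] := lav_closed LK (Fv e Ee gen).
    apply/nbhs_ballP; exists (r / 2) => /=; first lra.
    move=> w; rewrite -ball_normE /= => vw; apply: (F1 n e) => // Kw.
    have := Hr _ Kw.
    have -> : e - C w - (e - C v) = C (v - w) by rewrite CB; ring.
    by have := C_le (v - w); lra.
  move=> O [v Ov]; rewrite openE => /(_ v Ov) /nbhs_ballP[r /= r0 Or].
  have [a Ka ae] := lav_thin LK (e - C v) r0.
  exists (V (e - a)); split; last by apply: (F1 n e) => //; rewrite VK subKr.
  apply: Or; rewrite -ball_normE /=; apply: V_lt => //.
  by rewrite CB VK; have <- : a - (e - C v) = C v - (e - a) by ring.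
have [||v [vO vF]] := Baire odF (O := ball (0 : 'rV[R]_2) (del / 2)).
- by exists 0; apply: ballxx; rewrite divr_gt0.
- exact: ball_open.
exists (C v).
  move: vO; rewrite -ball_normE /= sub0r normrN => vd.
  by apply: le_lt_trans (C_le v) _; rewrite mulrC -ltr_pdivlMr.
by move=> e Ee; exact: (vF (g e) I e Ee erefl).
Qed.

(** For a nonconstant polynomial each fibre is the root set of a nonzero polynomial, hence
    finite. *)
Lemma countable_poly_preimage (A : set R[i]) p : (1 < size p)%N -> countable A ->
  countable [set z : Cplane R | A p.[z]].
Proof.
move=> sp cA.
have -> : [set z : Cplane R | A p.[z]] = \bigcup_(a in A) [set z | root (p - a%:P) z].
  apply/seteqP; split=> z /=.
    by move=> Az; exists p.[z] => //=; rewrite rootE !hornerE subrr.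
  by move=> [a Aa] /=; rewrite rootE !hornerE subr_eq0 => /eqP->.
apply: bigcup_countable => // a _; apply: finite_set_countable.
have pa0 : p - a%:P != 0.
  rewrite -size_poly_gt0 size_polyDl; first exact: ltnW.
  by rewrite size_polyN size_polyC; case: (a != 0) => //; exact: ltnW.
have [r rE] := closed_field_poly_normal (p - a%:P).
apply: (@sub_finite_set _ _ [set` r]); last exact: finite_seq.
move=> z /=; rewrite rE rootZ ?lead_coef_eq0 //.
by rewrite root_prod_XsubC.
Qed.

Lemma lavrentiev_approximation K (f : Cplane R -> Cplane R) :
  compact K -> lavrentiev_set K -> {within K, continuous f} ->
  uniform_limit_of_polys K f.
Proof.
move=> cK LK /within_continuous_normc cf.
have bndK := lav_bounded LK; have conjK := PK_conj LK.
have covK := compact_finitely_covered cK.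
(* Used with the real and imaginary parts, which do not increase distances. *)
have part (g : R[i] -> R) : (forall x y, `|g x - g y| <= normc (x - y)) ->
    uniform_limit_of_polys K (fun z => (g (f z))%:C%C).
  move=> g_le.
  have ug c e : K c -> 0 < e -> exists2 eta, 0 < eta &
      forall z, K z -> normc (z - c) < eta -> `|g (f z) - g (f c)| < e.
    move=> Kc e0; have [eta eta0 Heta] := cf c e Kc e0.
    by exists eta => // z Kz zc; apply: le_lt_trans (g_le _ _) _; exact: Heta.
  apply: (@PKr_continuous R K bndK conjK (g \o f)) => //.
  by apply: finitely_covered_bounded => // c Kc; exact: ug.
have PRe : uniform_limit_of_polys K (fun z => (Re (f z))%:C%C).
  by refine (part (@complex.Re R) _) => -[a b] [a' b']; exact: (Re_le_normc ((a +i* b) - (a' +i* b'))%C).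
have PIm : uniform_limit_of_polys K (fun z => (Im (f z))%:C%C).
  by refine (part (@complex.Im R) _) => -[a b] [a' b']; exact: (Im_le_normc ((a +i* b) - (a' +i* b'))%C).
apply: PK_ext (PK_add PRe (PK_scale bndK 'i%C PIm)) => z _.
by rewrite [RHS]complexE.
Qed.

End PlaneTopology.

(** * Approximation by a polynomial whose values on [K] avoid [A] *)

Theorem theorem2 (R : realType) (A K : set (Cplane R))
    (f : Cplane R -> Cplane R)
    (countableA : countable A)
    (compactK : compact K)
    (connectedCK : connected (~` K))
    (interiorK : interior K = set0)
    (continuousf : {within K, continuous f})
    (eps : R) (eps_gt0 : 0 < eps) :
  exists p : {poly R[i]},
    (forall z, K z -> ~ A p.[z]) /\
    (K !=set0 ->
       exists2 m : R[i],
         @is_maximum _ R[i] [set `|f z - p.[z]| | z in K] m & m < (eps%:C)%C).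
Proof.
have LK := compact_lavrentiev_set compactK connectedCK interiorK.
have [M HM] := lav_bounded LK.
have e3 : 0 < eps / 3 by lra.
have [p0 fp0] := lavrentiev_approximation compactK LK continuousf e3.
(* The preimage of [A] is countable only under a nonconstant polynomial; to a constant [p0] a small
   multiple of ['X] is added. *)
have [p1 sp1 p01] : exists2 p1 : {poly R[i]}, (1 < size p1)%N &
    forall z, K z -> normc (p0.[z] - p1.[z]) < eps / 3.
  have [sp0|sp0] := ltnP 1 (size p0).
    by exists p0 => // z Kz; rewrite subrr normc0.
  have M0 := normr_ge0 M.
  pose a : R := eps / 3 / (`|M| + 1).
  have a0 : 0 < a by rewrite /a divr_gt0 //; lra.
  have aC : a%:C%C != 0 :> R[i] by rewrite -normc_gt0 normc_real normr_gt0 lt0r_neq0.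
  exists (p0 + a%:C%C *: 'X).
    by rewrite addrC size_polyDl size_scale // size_polyX.
  move=> z Kz; rewrite !hornerE.
  have -> : p0.[z] - (p0.[z] + a%:C%C * z) = - (a%:C%C * z) by ring.
  rewrite normc_opp normcM normc_real gtr0_norm //.
  have zM : normc z < `|M| + 1 by have := HM z Kz; have := ler_norm M; lra.
  have -> : eps / 3 = a * (`|M| + 1) by rewrite /a divfK // lt0r_neq0 //; lra.
  by rewrite ltr_pM2l.
(* The translation has modulus below 1, so [z + t] stays in the disc of radius [M + 1]. *)
have [L L0 HL] := poly_lipschitz p1 (M + 1).
have d0 : 0 < Num.min 1 (eps / 3 / L) by rewrite lt_min ltr01 divr_gt0.
have [t] := exists_translate_avoiding LK (countable_poly_preimage sp1 countableA) d0.
rewrite lt_min ltr_pdivlMr // => /andP[t1 tL] avoid.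
(* If [p] took a value in [A] at [z] in [K], then [e = z + t] would be in the preimage of [A] under
   [p1] with [e - t] in [K], which the choice of [t] excludes. *)
pose p := p1 \Po ('X + t%:P).
have pE z : p.[z] = p1.[z + t] by rewrite horner_comp !hornerE.
have pe z : K z -> normc (f z - p.[z]) < eps.
  move=> Kz; have h1 := fp0 z Kz; have h2 := p01 z Kz.
  have h3 : normc (p1.[z] - p.[z]) <= L * normc t.
    rewrite pE; have := HL z (z + t).
    have -> : z - (z + t) = - t by ring.
    rewrite normc_opp; apply; first by have := HM z Kz; lra.
    by have := normc_triangle z t; have := HM z Kz; lra.
  have := normc_triangle3 p0.[z] (f z) p.[z]; have := normc_triangle3 p1.[z] p0.[z] p.[z].
  lra.
exists p; split=> [z Kz|K0].
  rewrite pE => Apz; apply: (avoid (z + t)) => //.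
  by rewrite addrK.
(* The maximum is sought for the real-valued modulus, by the extreme value theorem, and then carried
   to the order of [R[i]], where norms are real. *)
have cont : {within K, continuous (fun z => normc (f z - p.[z]))}.
  apply: normc_within_continuous => c e Kc e0; have e2 : 0 < e / 2 by lra.
  have [r r0 Hr] := within_continuous_normc continuousf Kc e2.
  have [L' L'0 HL'] := poly_lipschitz p M.
  exists (Num.min r (e / 2 / L')); first by rewrite lt_min r0 divr_gt0.
  move=> z Kz; rewrite lt_min ltr_pdivlMr // => /andP[zr zL].
  have h1 := Hr z Kz zr; have h2 := HL' z c (HM z Kz) (HM c Kc).
  have h3 := normc_triangleB (f z - f c) (p.[z] - p.[c]).
  have h4 := normc_subr_ge (f z - p.[z]) (f c - p.[c]).
  have h5 := normc_subr_ge (f c - p.[c]) (f z - p.[z]).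
  rewrite [normc (_ - (f z - _))]normc_sub in h5.
  have e1 : f z - p.[z] - (f c - p.[c]) = f z - f c - (p.[z] - p.[c]) by ring.
  rewrite e1 in h4 h5.
  by rewrite ltr_norml; lra.
have [c Kc cmax] := compact_EVT_max K0 compactK cont.
rewrite inE in Kc.
exists `|f c - p.[c]|; last first.
  by rewrite -[X in X < _]/((normc (f c - p.[c]))%:C)%C ltcR pe.
split; first by exists c.
move=> _ [z Kz <-].
rewrite -[X in X <= _]/((normc (f z - p.[z]))%:C)%C -[X in _ <= X]/((normc (f c - p.[c]))%:C)%C.
by rewrite lecR cmax // inE.
Qed.
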